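(* Let $f$ be any function with property $P^{\ast}$ and let $n\geq 6$. Then for every tree $T$ of order $n$ with $T\not\cong S_{n}$, $T\not\cong S_{2,n-2}$, $T\not\cong S_{3,n-3}$, we have $$\rho(A_{f}(T))<\rho(A_{f}(S_{3,n-3}))<\rho(A_{f}(S_{2,n-2}))<\rho(A_{f}(S_{n})).$$ That is, $S_{n}$, $S_{2,n-2}$, $S_{3,n-3}$ are, respectively, the unique trees of order $n$ with the first, second and third largest spectral radius of $A_f$.
   Context: All graphs are simple and connected; $d_i$ denotes the degree of vertex $v_i$. A function $f(x,y)$ (positive, symmetric in $x,y$, twice differentiable in $x$) has property $P^{\ast}$ if $f(x,y)>0$, $f'_x(x,y)\geq 0$ and $f''_x(x,y)\geq 0$ (increasing and convex in $x$), and whenever $x_1+y_1=x_2+y_2$ and $|x_1-y_1|>|x_2-y_2|$ we have $f(x_1,y_1)\geq f(x_2,y_2)$. For a graph $G$ on $\{v_1,\dots,v_n\}$, the weighted adjacency matrix $A_f(G)$ has $(i,j)$-entry $f(d_i,d_j)$ if $v_iv_j\in E(G)$ and $0$ otherwise; $\rho(A_f(G))$ denotes its largest eigenvalue. $S_n$ is the star of order $n$. For $2\leq d\leq\lfloor n/2\rfloor$, the double star $S_{d,n-d}$ is the tree of order $n$ consisting of two adjacent vertices $v_1,v_2$, where $v_1$ is adjacent to $d-1$ further pendant vertices and $v_2$ to $n-d-1$ further pendant vertices (so $d_{1}=d$, $d_{2}=n-d$). *)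

(* Defs.v *)
From HB Require Import structures.
From mathcomp Require Import all_boot all_order all_algebra.
From mathcomp Require Import all_classical all_reals all_analysis.
Set Implicit Arguments. Unset Strict Implicit. Unset Printing Implicit Defensive.
Import Order.TTheory GRing.Theory Num.Theory.
Local Open Scope ring_scope.
Local Open Scope classical_set_scope.

Definition simple_graph (n : nat) (e : rel 'I_n) : Prop :=
  (forall i, ~~ e i i) /\ (forall i j, e i j = e j i).

Definition deg (n : nat) (e : rel 'I_n) (i : 'I_n) : nat := #|[set j | e i j]|.

Definition nedges (n : nat) (e : rel 'I_n) : nat :=
  #|[set p : 'I_n * 'I_n | e p.1 p.2 && (p.1 < p.2)%N]|.

Definition connected_graph (n : nat) (e : rel 'I_n) : Prop :=
  forall i j : 'I_n, connect e i j.

Definition is_tree (n : nat) (e : rel 'I_n) : Prop :=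
  simple_graph e /\ connected_graph e /\ nedges e = n.-1.

Definition graph_iso (n : nat) (e1 e2 : rel 'I_n) : Prop :=
  exists s : 'I_n -> 'I_n, bijective s /\ forall i j, e1 i j = e2 (s i) (s j).

Definition star_graph (n : nat) : rel 'I_n :=
  fun i j => ((val i == 0%N) && (val j != 0%N)) || ((val j == 0%N) && (val i != 0%N)).

(* The double star S_{d,n-d}: v_1 = 0 and v_2 = 1 adjacent, vertices 2..d
   pendant at 0 (d-1 of them), vertices d+1..n-1 pendant at 1 (n-d-1 of them). *)
Definition dstar_adj (d : nat) (a b : nat) : bool :=
  [|| (a == 0%N) && (b == 1%N),
      (a == 0%N) && (2 <= b <= d)%N
    | (a == 1%N) && (d < b)%N ].

Definition double_star (n d : nat) : rel 'I_n :=
  fun i j => dstar_adj d (val i) (val j) || dstar_adj d (val j) (val i).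

Definition property_Pstar (R : realType) (f : R -> R -> R) : Prop :=
  [/\ (forall x y, 0 < x -> 0 < y -> 0 < f x y),
      (forall x y, 0 < x -> 0 < y -> f x y = f y x),
      (forall x y, 0 < x -> 0 < y ->
          derivable (fun t => f t y) x 1 /\
          derivable (fun t => f t y)^`() x 1),
      (forall x y, 0 < x -> 0 < y ->
          0 <= (fun t => f t y)^`() x /\ 0 <= ((fun t => f t y)^`())^`() x)
    & (forall x1 y1 x2 y2, 0 < x1 -> 0 < y1 -> 0 < x2 -> 0 < y2 ->
          x1 + y1 = x2 + y2 -> `|x2 - y2| < `|x1 - y1| ->
          f x2 y2 <= f x1 y1)].

Definition Af (R : realType) (f : R -> R -> R) (n : nat) (e : rel 'I_n) : 'M[R]_n :=
  \matrix_(i, j) (if e i j then f (deg e i)%:R (deg e j)%:R else 0).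

Definition rho (R : realType) (n : nat) (A : 'M[R]_n) : R :=
  sup [set a : R | eigenvalue A a].

Arguments star_graph n : clear implicits.
Arguments double_star n d : clear implicits.

(* Main.v *)
Require Import Defs.
From HB Require Import structures.
From mathcomp Require Import all_boot all_order all_algebra.
From mathcomp Require Import all_classical all_reals all_analysis.
From mathcomp Require Import perm ring lra zify.
Import Order.TTheory GRing.Theory Num.Theory.
Import numFieldNormedType.Exports.
Local Open Scope ring_scope.

(* Everything is done with Rayleigh quotients at the positive Perron vector [x] of [T];
   no intermediate tree is built, the target is always a double star placed on the
   vertices of [T] itself.  Suppose first that removing some edge [uv] leaves sides
   [A], [~: A] with at least 3 vertices each.  Let [a], [b] maximize [x] on the two sides,
   and compare with the double star with centers [a], [b].  Rooting [T] at [a] assigns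
   to every [w] in [A] other than [a] its parent edge; the end degrees of an edge inside
   [A] sum to at most [#|A| + 1], so its weight is at most [f 1 #|A|], while the parent has
   an entry at most [x a].  Likewise in [~: A], and [uv] is dominated by [ab].  So the
   spectral radius does not decrease, strictly unless [T] is that double star, and
   moving a pendant vertex to the larger center increases it by convexity of [f].
   Otherwise [T] is a spider with legs of length 1 or 2.  If it is neither a star nor
   [S_{2,n-2}], it has two legs of length 2, and [S_{3,n-3}] dominates because
   [f 3 m + f 1 m >= 2 * f 2 m]. *)

(** * Spectral radius and Rayleigh quotients *)

Definition quad {R : realType} {n : nat} (A : 'M[R]_n) (x : 'I_n -> R) : R :=
  \sum_i \sum_j A i j * (x i * x j).

Lemma quadD {R : realType} {n : nat} (B : 'M[R]_n) (x z : 'I_n -> R) t :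
  quad B (fun i => x i + t * z i) = quad B x
    + (t * (\sum_i \sum_j B i j * (x i * z j))
       + t * (\sum_i \sum_j B i j * (z i * x j))) + t ^+ 2 * quad B z.
Proof.
rewrite /quad !mulr_sumr -!big_split /=; apply: eq_bigr => i _.
by rewrite !mulr_sumr -!big_split /=; apply: eq_bigr => j _; ring.
Qed.

(** Moving from [x] in the direction [z = B x] changes the form by [2 t |z|^2 + t^2 (quad B z)],
    which is positive for small [t > 0] unless [z = 0]. *)
Lemma nsd_isotropic {R : realType} {n : nat} (B : 'M[R]_n) (x : 'I_n -> R) :
  (forall i j, B i j = B j i) -> (forall y, quad B y <= 0) -> quad B x = 0 ->
  forall i, \sum_j B i j * x j = 0.
Proof.
move=> symB nsdB qx0.
pose z i := \sum_j B i j * x j; pose S := \sum_i z i ^+ 2.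
have S_ge0 : 0 <= S by apply: sumr_ge0 => i _; exact: sqr_ge0.
have qD t : quad B (fun i => x i + t * z i) = t * S *+ 2 + t ^+ 2 * quad B z.
  have bxz : \sum_i \sum_j B i j * (x i * z j) = S.
    rewrite exchange_big /=; apply: eq_bigr => j _.
    rewrite expr2 {2}/z mulr_suml; apply: eq_bigr => i _.
    by rewrite (symB j i); ring.
  have bzx : \sum_i \sum_j B i j * (z i * x j) = S.
    apply: eq_bigr => i _; rewrite expr2 {3}/z mulr_sumr.
    by apply: eq_bigr => j _; ring.
  by rewrite quadD bxz bzx qx0; ring.
have S0 : S = 0.
  apply/eqP; rewrite eq_le S_ge0 andbT leNgt; apply/negP => S_gt0.
  pose K := - quad B z; have K_ge0 : 0 <= K by rewrite oppr_ge0.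
  (* With [K = - quad B z], this step size turns [2 t S - t^2 K] into [S^2 (2 + K) / (1 + K)^2 > 0];
     the added [1] keeps the denominator positive. *)
  have := nsdB (fun i => x i + S / (1 + K) * z i); rewrite qD => H.
  have K1 : 0 < 1 + K by lra.
  have e1 : S / (1 + K) * S *+ 2 + (S / (1 + K)) ^+ 2 * quad B z
     = S ^+ 2 / (1 + K) ^+ 2 * (2 + K).
    rewrite -(opprK (quad B z)) -/K; field; lra.
  move: H; rewrite e1 leNgt => /negP; apply.
  by apply: mulr_gt0; [rewrite divr_gt0 // exprn_gt0|lra].
move=> i; apply/eqP; rewrite -sqrf_eq0.
by move: S0 => /psumr_eq0P/(_ i isT) -> // j _; exact: sqr_ge0.
Qed.

Lemma continuous_sum {R : realType} {T : topologicalType} {I : finType}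
    (F : I -> T -> R) :
  (forall i, continuous (F i)) -> continuous (fun x => \sum_i F i x).
Proof.
move=> cF; apply: continuous_big => // x; exact: add_continuous.
Qed.

(** Library eigenvectors are rows multiplied on the left of the matrix; symmetry turns them into
    functions with [A x = a x]. *)
Lemma eigenvalueE {R : realType} {n : nat} (A : 'M[R]_n) a :
  (forall i j, A i j = A j i) -> eigenvalue A a ->
  exists2 x : 'I_n -> R, (exists i, x i != 0) & forall i, \sum_j A i j * x j = a * x i.
Proof.
move=> symA /eigenvalueP[v vA v0]; exists (v ord0).
  apply/existsP; apply: contra_neqT v0; rewrite negb_exists => /forallP v0.
  by apply/rowP => j; rewrite mxE; apply/eqP; have := v0 j; rewrite negbK.
move=> i; have := congr1 (fun w : 'rV_n => w ord0 i) vA; rewrite !mxE => <-.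
by apply: eq_bigr => j _; rewrite symA mulrC.
Qed.

Lemma eigenvalue_intro {R : realType} {n : nat} (A : 'M[R]_n) a (x : 'I_n -> R) i0 :
  (forall i j, A i j = A j i) -> x i0 != 0 ->
  (forall i, \sum_j A i j * x j = a * x i) -> eigenvalue A a.
Proof.
move=> symA x0 xA; apply/eigenvalueP; exists (\row_j x j).
  apply/rowP => j; rewrite !mxE -xA; apply: eq_bigr => k _.
  by rewrite mxE symA mulrC.
by apply: contra_neq x0 => /(congr1 (fun w : 'rV_n => w ord0 i0)); rewrite !mxE.
Qed.

Lemma quad_eig {R : realType} {n : nat} (A : 'M[R]_n) a (x : 'I_n -> R) :
  (forall i, \sum_j A i j * x j = a * x i) -> quad A x = a * \sum_i x i ^+ 2.
Proof.
move=> xA; rewrite /quad mulr_sumr; apply: eq_bigr => i _.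
transitivity (x i * \sum_j A i j * x j); last by rewrite xA; ring.
by rewrite mulr_sumr; apply: eq_bigr => j _; ring.
Qed.

(** The form is continuous and the unit sphere is compact, so a maximum exists; homogeneity extends
    the bound from the sphere to every [y]. *)
Lemma quad_max {R : realType} {n : nat} (A : 'M[R]_n) : (0 < n)%N ->
  exists x : 'I_n -> R, \sum_i x i ^+ 2 = 1 /\
  forall y, quad A y <= quad A x * \sum_i y i ^+ 2.
Proof.
move=> n0; pose sq (v : 'rV[R]_n) : R := \sum_i v ord0 i ^+ 2.
pose q (v : 'rV[R]_n) : R := quad A (v ord0).
have csq : continuous sq.
  apply: continuous_sum => i v.
  apply: (@continuous_comp _ _ _ (fun v : 'rV[R]_n => v ord0 i) (fun x => x ^+ 2)).
    exact: coord_continuous.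
  exact: exprn_continuous.
have cq : continuous q.
  apply: continuous_sum => i; apply: continuous_sum => j v.
  have cM (g h : 'rV[R]_n -> R) : {for v, continuous g} -> {for v, continuous h} ->
      {for v, continuous (fun w => g w * h w)}.
    by move=> cg ch; exact: (@cvgM R _ (nbhs v) _ g h (g v) (h v) cg ch).
  apply: (cM (fun=> A i j)); first exact: cst_continuous.
  by apply: (cM (fun w => w ord0 i) (fun w => w ord0 j)); exact: coord_continuous.
pose S := (sq @^-1` [set 1])%classic.
have S_sq v i : S v -> `|v ord0 i| <= 1.
  rewrite /S /= => Sv; rewrite -(@expr_le1 _ 2) //.
  rewrite real_normK ?num_real // -Sv /sq (bigD1 i) //= lerDl.
  by apply: sumr_ge0 => j _; exact: sqr_ge0.
have cptS : compact S.
  apply: bounded_closed_compact; last first.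
    apply: (@preimage_closed _ _ sq); [by move=> v _; exact: csq|exact: closed_eq].
  exists 1; split => // M M1 v Sv; apply: le_trans (ltW M1).
  rewrite /Num.norm /= mx_normrE; apply/bigmax_leP; split; first exact: ler01.
  by move=> [a b] _ /=; rewrite ord1; exact: S_sq.
have S0 : (S !=set0)%classic.
  exists (delta_mx ord0 (Ordinal n0)); rewrite /S /= /sq (bigD1 (Ordinal n0)) //=.
  rewrite mxE !eqxx expr1n big1 ?addr0 // => j /negPf jn.
  by rewrite mxE jn andbF expr0n.
have [|c cS cmax] := EVT_max_rV S0 cptS (f := q).
  by apply: continuous_subspaceT => v; exact: cq.
exists (c ord0); split; first by move: cS; rewrite inE.
move=> y; pose N := \sum_i y i ^+ 2.
have N_ge0 : 0 <= N by apply: sumr_ge0 => j _; exact: sqr_ge0.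
have [N0|N_neq0] := eqVneq N 0.
  have y0 i : y i = 0.
    apply/eqP; rewrite -sqrf_eq0; move: N0 => /psumr_eq0P/(_ i isT) -> // j _.
    exact: sqr_ge0.
  by rewrite -/N N0 mulr0 /quad big1 // => i _; rewrite big1 // => j _; rewrite !y0; ring.
have N_gt0 : 0 < N by rewrite lt_neqAle eq_sym N_neq0.
have s2 : Num.sqrt N ^+ 2 = N by rewrite sqr_sqrtr.
have s0 : Num.sqrt N != 0 by rewrite sqrtr_eq0 -ltNge.
pose v : 'rV[R]_n := \row_i (y i / Num.sqrt N).
have vS : v \in S.
  rewrite inE /S /= /sq; transitivity (N / N); last by rewrite divff.
  rewrite /N mulr_suml; apply: eq_bigr => i _.
  by rewrite mxE expr_div_n s2.
have /= := cmax v vS; rewrite /q; have -> : quad A (v ord0) = quad A y / N.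
  rewrite /quad mulr_suml; apply: eq_bigr => i _.
  rewrite mulr_suml; apply: eq_bigr => j _; rewrite !mxE -[in RHS]s2; field.
  exact: s0.
by rewrite ler_pdivrMr.
Qed.

(** The form of [A - l I] is negative semidefinite and vanishes at [x], so [nsd_isotropic] puts [x]
    in its kernel. *)
Lemma maximizer_eig {R : realType} {n : nat} (A : 'M[R]_n) l (x : 'I_n -> R) :
  (forall i j, A i j = A j i) ->
  (forall y, quad A y <= l * \sum_i y i ^+ 2) ->
  quad A x = l * \sum_i x i ^+ 2 ->
  forall i, \sum_j A i j * x j = l * x i.
Proof.
move=> symA lmax xmax i; pose B : 'M[R]_n := A - l%:M.
have BE y i' : \sum_j B i' j * y j = \sum_j A i' j * y j - l * y i'.
  rewrite (eq_bigr (fun j => A i' j * y j - l * y j *+ (i' == j))).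
    rewrite sumrB; congr (_ - _); rewrite (bigD1 i') //= eqxx big1 ?addr0 // => j.
    by rewrite eq_sym => /negPf ->.
  by move=> j _; rewrite !mxE mulrBl; case: eqP; rewrite ?mul0r.
have qB y : quad B y = quad A y - l * \sum_i y i ^+ 2.
  rewrite mulr_sumr -sumrB; apply: eq_bigr => i' _.
  transitivity (y i' * \sum_j B i' j * y j).
    by rewrite mulr_sumr; apply: eq_bigr => j _; ring.
  rewrite BE mulrBr mulr_sumr; congr (_ - _); last by ring.
  by apply: eq_bigr => j _; ring.
have := @nsd_isotropic _ _ B x _ _ _ i; rewrite BE => H.
apply/eqP; rewrite -subr_eq0 H //.
- by move=> a b; rewrite !mxE symA eq_sym.
- by move=> y; rewrite qB subr_le0 lmax.
- by rewrite qB xmax subrr.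
Qed.

(** The maximum of the Rayleigh quotient is an eigenvalue and bounds all the others, so it is the
    supremum defining [rho]. *)
Lemma rho_max {R : realType} {n : nat} (A : 'M[R]_n) : (0 < n)%N ->
  (forall i j, A i j = A j i) ->
  (exists2 x : 'I_n -> R, \sum_i x i ^+ 2 = 1 & quad A x = rho A) /\
  (forall y, quad A y <= rho A * \sum_i y i ^+ 2).
Proof.
move=> n0 symA; have [x [x1 xmax]] := quad_max A n0.
have xeig : forall i, \sum_j A i j * x j = quad A x * x i.
  by apply: maximizer_eig => //; rewrite x1 mulr1.
have ub : ubound [set a | eigenvalue A a]%classic (quad A x).
  move=> a /= /(eigenvalueE _ _ symA)[y [i0 y0] /(quad_eig _ _ _) ya].
  have := xmax y; rewrite ya ler_pM2r // (bigD1 i0) //=.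
  apply: ltr_pwDl; first by rewrite exprn_even_gt0.
  by apply: sumr_ge0 => j _; exact: sqr_ge0.
have [i0 x0] : exists i, x i != 0.
  apply/existsP; have := oner_neq0 R; apply: contra_neqT.
  rewrite negb_exists -x1 => /forallP x0; rewrite big1 // => i _.
  by have := x0 i; rewrite negbK => /eqP ->; rewrite expr0n.
have ev : eigenvalue A (quad A x) by exact: (eigenvalue_intro _ _ x i0).
have -> : rho A = quad A x.
  apply/eqP; rewrite eq_le /rho; apply/andP; split.
    by apply: ge_sup => //; exists (quad A x).
  by apply: ub_le_sup => //; exists (quad A x).
by split=> //; exists x.
Qed.

(** Taking absolute values of a unit maximizer does not lower a form with nonnegative entries, so
    [|x|] is again an eigenvector. A zero entry adjacent to a positive one would contradict its row
    of the eigenvalue equation, hence positivity spreads along edges. *)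
Lemma perron {R : realType} {n : nat} (A : 'M[R]_n) (e : rel 'I_n) : (0 < n)%N ->
  (forall i j, A i j = A j i) -> (forall i j, 0 <= A i j) ->
  (forall i j, e i j -> 0 < A i j) -> (forall i j, connect e i j) ->
  exists2 x : 'I_n -> R, (forall i, 0 < x i) &
    forall i, \sum_j A i j * x j = rho A * x i.
Proof.
move=> n0 symA A_ge0 eA econ; have [[x x1 qx] qmax] := rho_max _ n0 symA.
pose y i := `|x i|.
have y1 : \sum_i y i ^+ 2 = 1.
  by rewrite -x1; apply: eq_bigr => i _; rewrite real_normK ?num_real.
have yeig : forall i, \sum_j A i j * y j = rho A * y i.
  apply: maximizer_eig => //; apply/eqP; rewrite eq_le qmax y1 mulr1 -qx /=.
  apply: ler_sum => i _; apply: ler_sum => j _.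
  by rewrite ler_wpM2l // -normrM ler_norm.
have y_ge0 i : 0 <= y i by exact: normr_ge0.
have [i0 y0] : exists i, y i != 0.
  apply/existsP; have := oner_neq0 R; apply: contra_neqT.
  rewrite negb_exists -y1 => /forallP y0; rewrite big1 // => i _.
  by have := y0 i; rewrite negbK => /eqP ->; rewrite expr0n.
have ystep i j : e i j -> 0 < y i -> 0 < y j.
  move=> eij yi; rewrite lt_neqAle y_ge0 andbT eq_sym; apply/negP => /eqP yj.
  have := yeig j; rewrite yj mulr0 (bigD1 i) //= => H.
  have : 0 < A j i * y i by rewrite mulr_gt0 // symA eA.
  have : 0 <= \sum_(k | k != i) A j k * y k by apply: sumr_ge0 => k _; rewrite mulr_ge0.
  lra.
exists y => // i; have /connectP[p] := econ i0 i.
have {y0}: 0 < y i0 by rewrite lt_neqAle eq_sym y0 y_ge0.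
elim: p i0 => [|k p IH] i0 /= y0; first by move=> _ ->.
by move=> /andP[e0 pp] lst; apply: IH pp lst; exact: ystep e0 y0.
Qed.

(** The Rayleigh quotient at [x] gives [rho A <= rho B]. Equality would make [x] a maximizer for [B]
    too, hence an eigenvector for the same value, and then all rows [A x] and [B x] agree. One
    differing row therefore yields strictness. *)
Lemma rho_lt {R : realType} {n : nat} (A B : 'M[R]_n) (x : 'I_n -> R) i0 :
  (forall i j, B i j = B j i) -> (forall i, 0 < x i) ->
  (forall i, \sum_j A i j * x j = rho A * x i) ->
  quad A x <= quad B x -> \sum_j A i0 j * x j != \sum_j B i0 j * x j ->
  rho A < rho B.
Proof.
move=> symB x_gt0 xA qAB neq.
have n0 : (0 < n)%N := leq_ltn_trans (leq0n i0) (ltn_ord i0).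
have [_ Bmax] := rho_max _ n0 symB.
have x2 : 0 < \sum_i x i ^+ 2.
  rewrite (bigD1 i0) //= ltr_pwDl ?exprn_gt0 //.
  by apply: sumr_ge0 => j _; exact: sqr_ge0.
have qA := quad_eig _ _ _ xA.
have le : rho A <= rho B.
  by rewrite -(ler_pM2r x2) -qA (le_trans qAB) // Bmax.
rewrite lt_neqAle le andbT; apply: contra neq => /eqP eAB.
rewrite xA eAB eq_sym; apply/eqP; apply: maximizer_eig => //.
by apply/eqP; rewrite eq_le Bmax -eAB -qA.
Qed.

(** * Invariance under graph isomorphism *)

Lemma eigenvalue_perm {R : realType} {n : nat} (A B : 'M[R]_n) (s : 'I_n -> 'I_n) a :
  bijective s -> (forall i j, A i j = B (s i) (s j)) ->
  eigenvalue A a -> eigenvalue B a.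
Proof.
move=> [t st ts] AB /eigenvalueP[v vA v0].
have bs : bijective s by exists t.
apply/eigenvalueP; exists (\row_j v ord0 (t j)).
  apply/rowP => j; rewrite !mxE (reindex s) /=; last exact: onW_bij.
  have := congr1 (fun w : 'rV_n => w ord0 (t j)) vA; rewrite !mxE => <-.
  by apply: eq_bigr => k _; rewrite AB mxE st ts.
apply: contra_neq v0 => v0; apply/rowP => j.
by have := congr1 (fun w : 'rV_n => w ord0 (s j)) v0; rewrite !mxE st.
Qed.

(* In Defs the comprehensions under [#|_|] are classical sets, not finsets. *)
Lemma degE {n : nat} (e : rel 'I_n) i : deg e i = #|[pred j | e i j]|.
Proof. by apply: eq_card => j; rewrite [LHS]unfold_in /= asboolb inE. Qed.

Lemma nedgesE {n : nat} (e : rel 'I_n) :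
  nedges e = #|[pred p : 'I_n * 'I_n | e p.1 p.2 && (p.1 < p.2)%N]|.
Proof. by apply: eq_card => j; rewrite [LHS]unfold_in /= asboolb inE. Qed.

Lemma deg_iso {n : nat} (e1 e2 : rel 'I_n) s : bijective s ->
  (forall i j, e1 i j = e2 (s i) (s j)) -> forall i, deg e1 i = deg e2 (s i).
Proof.
move=> bs e12 i; rewrite !degE -[RHS](on_card_preimset (f := s)); last exact: onW_bij.
by apply: eq_card => j; rewrite !inE e12.
Qed.

Lemma rho_iso {R : realType} {n : nat} (f : R -> R -> R) (e1 e2 : rel 'I_n) :
  graph_iso e1 e2 -> rho (Af f e1) = rho (Af f e2).
Proof.
move=> [s [bs e12]].
have AB i j : Af f e1 i j = Af f e2 (s i) (s j).
  by rewrite !mxE e12 !(deg_iso _ _ _ bs e12).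
have [t st ts] := bs; rewrite /rho; congr sup; apply/seteqP; split => a /=.
  exact: (eigenvalue_perm _ _ s).
by apply: (eigenvalue_perm _ _ t); [exists s|move=> i j; rewrite AB !ts].
Qed.

(** * Weighted adjacency under P* *)

Definition weight {R : realType} (f : R -> R -> R) {n : nat} (e : rel 'I_n) i j : R :=
  f (deg e i)%:R (deg e j)%:R.

Lemma Af_row {R : realType} (f : R -> R -> R) {n : nat} (e : rel 'I_n) (x : 'I_n -> R) i :
  \sum_j Af f e i j * x j = \sum_(j | e i j) weight f e i j * x j.
Proof.
by rewrite [RHS]big_mkcond; apply: eq_bigr => j _; rewrite mxE; case: ifP; rewrite ?mul0r.
Qed.

Lemma quad_Af {R : realType} (f : R -> R -> R) {n : nat} (e : rel 'I_n) (x : 'I_n -> R) :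
  quad (Af f e) x = \sum_i \sum_(j | e i j) weight f e i j * (x i * x j).
Proof.
apply: eq_bigr => i _; rewrite [RHS]big_mkcond; apply: eq_bigr => j _.
by rewrite mxE; case: ifP; rewrite ?mul0r.
Qed.

Lemma deg_gt0 {n : nat} (e : rel 'I_n) i j : e i j -> (0 < deg e i)%N.
Proof. by move=> eij; apply/card_gt0P; exists j; rewrite inE. Qed.

Section Weighted.
Context {R : realType} {f : R -> R -> R} (hf : property_Pstar f).

Lemma Pstar_gt0 x y : 0 < x -> 0 < y -> 0 < f x y.
Proof. by have [h _ _ _ _] := hf; exact: h. Qed.

Lemma Pstar_sym x y : 0 < x -> 0 < y -> f x y = f y x.
Proof. by have [_ h _ _ _] := hf; exact: h. Qed.

Lemma Af_sym {n : nat} (e : rel 'I_n) : simple_graph e ->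
  forall i j, Af f e i j = Af f e j i.
Proof.
move=> [_ es] i j; rewrite !mxE (es j i); case: ifP => // eij.
by rewrite Pstar_sym // ltr0n; [exact: deg_gt0 eij|apply: (@deg_gt0 _ _ _ i); rewrite es].
Qed.

Lemma weight_gt0 {n : nat} (e : rel 'I_n) i j : simple_graph e -> e i j ->
  0 < weight f e i j.
Proof.
move=> [_ es] eij; apply: Pstar_gt0; rewrite ltr0n; first exact: deg_gt0 eij.
by apply: (@deg_gt0 _ _ _ i); rewrite es.
Qed.

Lemma Af_perron {n : nat} (e : rel 'I_n) : (0 < n)%N -> simple_graph e ->
  connected_graph e ->
  exists2 x : 'I_n -> R, (forall i, 0 < x i) &
    forall i, \sum_(j | e i j) weight f e i j * x j = rho (Af f e) * x i.
Proof.
move=> n0 se ce; have w0 i j : e i j -> 0 < Af f e i j.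
  by move=> eij; rewrite mxE eij; exact: weight_gt0.
have [|x x0 xA] := perron (Af f e) e n0 (Af_sym e se) _ w0 ce.
  move=> i j; case eij: (e i j); first exact/ltW/w0.
  by rewrite mxE eij.
by exists x => // i; rewrite -Af_row.
Qed.

Lemma Af_rho_lt {n : nat} (e1 e2 : rel 'I_n) (x : 'I_n -> R) i0 :
  simple_graph e2 -> (forall i, 0 < x i) ->
  (forall i, \sum_(j | e1 i j) weight f e1 i j * x j = rho (Af f e1) * x i) ->
  \sum_i \sum_(j | e1 i j) weight f e1 i j * (x i * x j) <=
    \sum_i \sum_(j | e2 i j) weight f e2 i j * (x i * x j) ->
  \sum_(j | e1 i0 j) weight f e1 i0 j * x j <
    \sum_(j | e2 i0 j) weight f e2 i0 j * x j ->
  rho (Af f e1) < rho (Af f e2).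
Proof.
move=> s2 x0 xA; rewrite -!quad_Af -!Af_row => le12 lt12.
apply: (rho_lt _ _ x i0) => //; first exact: Af_sym.
  by move=> i; rewrite Af_row.
by rewrite lt_eqF.
Qed.

Lemma Pstar_mvt (s t y : R) : 0 < s -> s < t -> 0 < y ->
  exists2 c, s < c < t & f t y - f s y = (fun u => f u y)^`()%classic c * (t - s).
Proof.
have [_ _ hd _ _] := hf; move=> s0 st y0.
have [||c] := @MVT _ (fun u => f u y) (fun u => f u y)^`()%classic s t st.
- move=> x; rewrite in_itv /= => /andP[sx _].
  by rewrite derive1E; apply/derivableP; have [] := hd x y (lt_trans s0 sx) y0.
- apply: derivable_within_continuous => x; rewrite in_itv /= => /andP[sx _].
  by have [] := hd x y (lt_le_trans s0 sx) y0.
by rewrite in_itv; exists c.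
Qed.

Lemma Pstar_mono (s t y : R) : 0 < s -> s <= t -> 0 < y -> f s y <= f t y.
Proof.
move=> s0; rewrite le_eqVlt => /predU1P[->//|st] y0.
have [c /andP[sc _] e] := Pstar_mvt s t y s0 st y0.
have [_ _ _ hp _] := hf; have [h _] := hp c y (lt_trans s0 sc) y0.
by rewrite -subr_ge0 e mulr_ge0 // subr_ge0 ltW.
Qed.

Lemma Pstar_derive_mono (s t y : R) : 0 < s -> s <= t -> 0 < y ->
  (fun u => f u y)^`()%classic s <= (fun u => f u y)^`()%classic t.
Proof.
have [_ _ hd hp _] := hf; move=> s0 st y0.
apply: (@ger0_derive1_ndecr _ (fun u => f u y)^`()%classic s t) => //.
- move=> x; rewrite in_itv /= => /andP[sx _].
  by have [] := hd x y (lt_trans s0 sx) y0.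
- move=> x; rewrite in_itv /= => /andP[sx _].
  by have [] := hp x y (lt_trans s0 sx) y0.
- apply: derivable_within_continuous => x; rewrite in_itv /= => /andP[sx _].
  by have [] := hd x y (lt_le_trans s0 sx) y0.
Qed.

(** By the mean value theorem the increments are derivatives at points [c < s + 1 <= t < d], and the
    derivative is nondecreasing. *)
Lemma Pstar_convex (s t y : R) : 0 < s -> s + 1 <= t -> 0 < y ->
  f (s + 1) y - f s y <= f (t + 1) y - f t y.
Proof.
move=> s0 st y0.
have [|c /andP[sc cs] ->] := Pstar_mvt s (s + 1) y s0 _ y0; first by lra.
have [||d /andP[td dt] ->] := Pstar_mvt t (t + 1) y _ _ y0; [lra|lra|].
have : (fun u => f u y)^`()%classic c <= (fun u => f u y)^`()%classic d.
  by apply: Pstar_derive_mono => //; lra.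
lra.
Qed.

End Weighted.

(** * Rooted trees *)

Definition parent_rel {T : eqType} (r : T) (par : T -> T) : rel T :=
  fun i j => (i != r) && (j == par i) || (j != r) && (i == par j).

(** The depth [d], decreasing towards the root, certifies acyclicity without counting edges. The
    convention [par r = r] lets [par] be iterated freely. *)
Definition rooted {n : nat} (e : rel 'I_n) r (par : 'I_n -> 'I_n) : Prop :=
  [/\ par r = r, (exists d : 'I_n -> nat, forall w, w != r -> (d (par w) < d w)%N)
    & forall i j, e i j = parent_rel r par i j].

(* Breadth-first parents give [n - 1] distinct edges, hence all of them. *)
Lemma tree_rooted {n : nat} (e : rel 'I_n) (r : 'I_n) : is_tree e ->
  exists par, rooted e r par.
Proof.
move=> [[eirr esym] [econ ecard]].
pose P (w : 'I_n) k := [exists p : k.-tuple 'I_n, path e r p && (last r p == w)].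
have exP w : exists k, P w k.
  have /connectP[p pp lp] := econ r w; exists (size p); apply/existsP.
  by exists (in_tuple p); rewrite pp lp eqxx.
pose d (w : 'I_n) := ex_minn (exP w).
have ex_par w : w != r -> exists j, e j w && (d j < d w)%N.
  move=> wr; rewrite [d w]/d; case: ex_minnP => k /existsP[[p /= /eqP <-]].
  case: (lastP p) => [|q z]; first by rewrite /= eq_sym (negPf wr).
  rewrite rcons_path last_rcons size_rcons => /andP[/andP[pq ez] /eqP zw] _.
  exists (last r q); rewrite -zw ez ltnS /d; case: ex_minnP => m _; apply.
  by apply/existsP; exists (in_tuple q); rewrite pq eqxx.
pose par (w : 'I_n) := if w == r then r else odflt r [pick j | e j w && (d j < d w)%N].
have parP w : w != r -> e (par w) w && (d (par w) < d w)%N.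
  move=> wr; rewrite /par (negPf wr); case: pickP => // none.
  by have [j] := ex_par w wr; rewrite none.
(* The edge from [w] to its parent, written in increasing order as [nedges] counts it. The distances
   [d] tell which end is the child, so [g] is injective off the root. *)
pose g (w : 'I_n) := if (w < par w)%N then (w, par w) else (par w, w).
pose E := [set p : 'I_n * 'I_n | e p.1 p.2 && (p.1 < p.2)%N]%SET.
have par_neq w : w != r -> par w != w.
  by move=> /parP /andP[_ h]; apply: contraTneq h => ->; rewrite ltnn.
have gE w : w != r -> g w \in E.
  move=> wr; have /andP[ew _] := parP w wr; rewrite inE /g; case: ltnP => /= h.
    by rewrite esym ew.
  by rewrite ew ltn_neqAle h andbT; exact: par_neq.
have ginj : {in [set~ r] &, injective g}.
  move=> w1 w2; rewrite !inE => r1 r2; rewrite /g.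
  have /andP[_ d1] := parP w1 r1; have /andP[_ d2] := parP w2 r2.
  case: ifP => _; case: ifP => _ [a b] //.
    by move: d1 d2; rewrite b -a; lia.
  by move: d1 d2; rewrite a -b; lia.
have gim : g @: [set~ r]%SET = E.
  apply/eqP; rewrite eqEcard; apply/andP; split.
    by apply/fintype.subsetP => p /imsetP[w]; rewrite !inE => wr ->; have := gE w wr; rewrite inE.
  rewrite card_in_imset // cardsC1 card_ord.
  by rewrite -ecard nedgesE cardsE.
exists par; split; first by rewrite /par eqxx.
  by exists d => w /parP /andP[].
move=> i j; apply/idP/idP; last first.
  by case/orP => /andP[/parP/andP[+ _] /eqP ->] //; rewrite esym.
move=> eij; wlog ij : i j eij / (i < j)%N.
  move=> H; have [ij|ji|/val_inj ij] := ltngtP i j; first exact: H.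
    by rewrite /parent_rel orbC; apply: H => //; rewrite esym.
  by move: eij; rewrite ij (negPf (eirr j)).
have : (i, j) \in E by rewrite inE eij.
rewrite -gim => /imsetP[w]; rewrite !inE /g => wr.
by case: ifP => _ [-> ->]; rewrite /parent_rel wr eqxx //= orbT.
Qed.

Section Rooted.
Context {n : nat} {e : rel 'I_n} {r : 'I_n} {par : 'I_n -> 'I_n}.
Context (re : rooted e r par).

Lemma rootedE i j : e i j = (i != r) && (j == par i) || (j != r) && (i == par j).
Proof. by have [_ _ ->] := re. Qed.

Lemma par_root : par r = r. Proof. by have [] := re. Qed.

Lemma edge_par w : w != r -> e w (par w).
Proof. by move=> wr; rewrite rootedE wr eqxx. Qed.

Lemma par_neq w : w != r -> par w != w.
Proof.
have [_ [d hd] _] := re; move=> /hd h; apply: contraTneq h => ->.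
by rewrite ltnn.
Qed.

Lemma par_asym v w : v != r -> w != r -> v = par w -> w <> par v.
Proof. by have [_ [d hd] _] := re; move=> /hd + /hd + vw wv; rewrite -vw -wv; lia. Qed.

Lemma rooted_ind (P : 'I_n -> Prop) :
  P r -> (forall w, w != r -> P (par w) -> P w) -> forall w, P w.
Proof.
have [_ [d hd] _] := re; move=> Pr Ps w; have [k] := ubnP (d w).
elim: k w => // k IH w; have [->|wr] := eqVneq w r => // hk.
by apply: Ps => //; apply: IH; have := hd w wr; lia.
Qed.

Lemma rooted_simple : simple_graph e.
Proof.
split=> [i|i j]; last by rewrite !rootedE orbC.
rewrite rootedE orbb; apply/negP => /andP[/par_neq + /eqP]; rewrite eq_sym => /eqP.
by [].
Qed.

Lemma rooted_connected : connected_graph e.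
Proof.
have cs : connect_sym e by apply: sym_connect_sym; have [] := rooted_simple.
have cr : forall i, connect e i r.
  apply: rooted_ind => // w wr; apply: connect_trans; apply: connect1.
  exact: edge_par.
by move=> i j; apply: (connect_trans (cr i)); rewrite cs.
Qed.

(** Each edge is indexed by its lower end and occurs once in each direction; by [par_asym] the two
    disjuncts describing an edge exclude each other. *)
Lemma rooted_sum {R : realType} (F : 'I_n -> 'I_n -> R) :
  \sum_i \sum_(j | e i j) F i j = \sum_(w | w != r) (F w (par w) + F (par w) w).
Proof.
have split_edge i : \sum_(j | e i j) F i j
    = \sum_j (if (i != r) && (j == par i) then F i j else 0)
      + \sum_j (if (j != r) && (i == par j) then F i j else 0).
  rewrite -big_split /= big_mkcond /=; apply: eq_bigr => j _.
  rewrite rootedE; case: (boolP (_ && _)) => [/andP[ir /eqP ji]|_] /=; last by rewrite add0r.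
  case: (boolP (_ && _)) => [/andP[jr /eqP ij]|_]; last by rewrite addr0.
  by have := par_asym j i jr ir ji.
under eq_bigr do rewrite split_edge.
rewrite big_split /= big_split /=; congr (_ + _).
  rewrite [RHS]big_mkcond; apply: eq_bigr => i _; rewrite -big_mkcond /=.
  case: (boolP (i == r)) => ir /=; first by rewrite big_pred0.
  by rewrite big_pred1_eq.
rewrite exchange_big [RHS]big_mkcond; apply: eq_bigr => j _; rewrite -big_mkcond /=.
case: (boolP (j == r)) => jr /=; first by rewrite big_pred0.
by rewrite big_pred1_eq.
Qed.

End Rooted.

(** Rooted at [k], two neighbours of [k] both have parent [k], so neither is the parent of the
    other. *)
Lemma tree_triangle_free {n : nat} (e : rel 'I_n) i j k : is_tree e ->
  e i j -> e i k -> ~~ e j k.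
Proof.
move=> te; have [par re] := tree_rooted e k te; have [[/(_ k) ekk es] _] := te.
move=> eij eik; apply/negP => ejk.
have parE h : e h k -> par h = k.
  by move=> hk; move: (hk); rewrite (rootedE re) eqxx /= orbF => /andP[_ /eqP].
move: eij; rewrite (rootedE re) !parE // => /orP[/andP[_ /eqP jk]|/andP[_ /eqP ik]].
  by move: ejk; rewrite jk (negPf ekk).
by move: eik; rewrite ik (negPf ekk).
Qed.

Lemma deg_le {n : nat} (e : rel 'I_n) (B : {set 'I_n}) i :
  (forall k, e i k -> k \in B) -> (deg e i <= #|B|)%N.
Proof. by move=> iB; rewrite degE; apply: subset_leq_card; apply/fintype.subsetP. Qed.

(** In a tree the neighbourhoods of adjacent vertices are disjoint, so their sizes add up inside
    [B]. *)
Lemma deg_add_le {n : nat} (e : rel 'I_n) (B : {set 'I_n}) i j : is_tree e -> e i j ->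
  (forall k, e i k -> k \in B) -> (forall k, e j k -> k \in B) ->
  (deg e i + deg e j <= #|B|)%N.
Proof.
move=> te eij iB jB; rewrite !degE -cardUI.
rewrite (_ : #|predI _ _| = 0)%N ?addn0.
  by apply: subset_leq_card; apply/fintype.subsetP => k; rewrite !inE => /orP[/iB|/jB].
apply: eq_card0 => k; rewrite !inE; apply/negP => /andP[ik jk].
by have := tree_triangle_free e i j k te eij ik; rewrite jk.
Qed.

(** * Descendants and edge cuts *)

Definition desc {n : nat} (par : 'I_n -> 'I_n) v : {set 'I_n} :=
  [set w | fconnect par w v]%SET.

(** The side [A] left by removing the edge [uv], described without components: [uv] is the only edge
    leaving [A]. *)
Definition edge_cut {n : nat} (e : rel 'I_n) (A : {set 'I_n}) u v : Prop :=
  [/\ u \in A, v \notin A, e u v &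
      forall i j, i \in A -> j \notin A -> e i j -> i = u /\ j = v].

Lemma cutC {n : nat} (e : rel 'I_n) A u v : simple_graph e ->
  edge_cut e A u v -> edge_cut e (~: A) v u.
Proof.
move=> [_ es] [uA vA euv Ac]; split; rewrite ?inE ?negbK ?(es v) //.
move=> i j; rewrite !inE negbK => iA jA eij.
by have [] := Ac j i jA iA _; rewrite ?(es j).
Qed.

Section Desc.
Context {n : nat} {e : rel 'I_n} {r : 'I_n} {par : 'I_n -> 'I_n}.
Context (re : rooted e r par).

Lemma desc_refl v : v \in desc par v. Proof. by rewrite inE connect0. Qed.

Lemma desc_trans u v w : u \in desc par v -> v \in desc par w -> u \in desc par w.
Proof. by rewrite !inE; exact: connect_trans. Qed.

Lemma desc_up v w : par w \in desc par v -> w \in desc par v.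
Proof. by rewrite !inE; apply: connect_trans; exact: fconnect1. Qed.

Lemma desc_down v w : w \in desc par v -> w != v -> par w \in desc par v.
Proof.
rewrite !inE => /connectP[[|x p] /= pp lv]; first by rewrite lv eqxx.
move: pp => /andP[/eqP xw pp] _; apply/connectP; exists p; by rewrite xw.
Qed.

Lemma desc_root : desc par r = [set: 'I_n]%SET.
Proof.
apply/setP => w; rewrite [RHS]inE; move: w; apply: (rooted_ind re); first exact: desc_refl.
by move=> w _; exact: desc_up.
Qed.

(** Every descendant of [v] is at least as deep as [v], while [par v] is strictly less deep. *)
Lemma par_notin_desc v : v != r -> par v \notin desc par v.
Proof.
have [pr [d hd] _] := re; move=> vr.
have dle w : (d (par w) <= d w)%N.
  by have [->|/hd/ltnW//] := eqVneq w r; rewrite pr.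
have dmono w : w \in desc par v -> (d v <= d w)%N.
  rewrite inE => /connectP[p pp ->]; elim: p w pp => //= x p IH w /andP[/eqP <- pp].
  exact: leq_trans (IH _ pp) (dle w).
by apply/negP => /dmono; rewrite leqNgt hd.
Qed.

Lemma root_notin_desc v : v != r -> r \notin desc par v.
Proof.
move=> vr; apply/negP => rv; have pr := par_root re.
move: rv (vr); rewrite inE => /connectP[p + ->]; elim: p => [|x p IH] /=.
  by rewrite eqxx.
by rewrite pr => /andP[/eqP <-]; exact: IH.
Qed.

Lemma desc_cut v : v != r -> edge_cut e (desc par v) v (par v).
Proof.
move=> vr; split; [exact: desc_refl|exact: par_notin_desc|exact: (edge_par re)|].
move=> i j iv jv; rewrite (rootedE re) => /orP[/andP[ir /eqP ji]|/andP[jr /eqP ij]].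
  have [iv'|iv'] := eqVneq i v; first by rewrite ji iv'.
  by move: jv; rewrite ji desc_down.
by move: jv; rewrite desc_up // -ij.
Qed.

End Desc.

(** * Double stars *)

(** Parents in the double star rooted at [a]. At [a] itself the value is [a] when [a \in A], as
    [rooted] demands. *)
Definition dstar_par {n : nat} (A : {set 'I_n}) (a b i : 'I_n) : 'I_n :=
  if (i \in A) || (i == b) then a else b.

(* The double star with centers [a \in A] and [b \notin A], the other vertices of [A]
   hanging at [a] and the other vertices of [~: A] hanging at [b]. *)
Definition dstar {n : nat} (A : {set 'I_n}) (a b : 'I_n) : rel 'I_n :=
  parent_rel a (dstar_par A a b).

Section Dstar.
Context {n : nat} (A : {set 'I_n}) (a b : 'I_n).
Context (aA : a \in A) (bA : b \notin A).

Let ab : a != b. Proof. by apply: contraTneq aA => ->. Qed.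

Lemma dstar_rooted : rooted (dstar A a b) a (dstar_par A a b).
Proof.
split=> //; first by rewrite /dstar_par aA.
exists (fun i => if i == a then 0 else if (i \in A) || (i == b) then 1 else 2)%N.
move=> w wa; rewrite /dstar_par (negPf wa).
by case: (boolP (_ || _)) => _ /=; rewrite ?eqxx ?orbT // [b == a]eq_sym (negPf ab).
Qed.

(** The two centers play symmetric roles, although the definition roots the graph at [a]. Facts
    proved on the side of [a] are carried to the side of [b] through this lemma. *)
Lemma dstarC : dstar A a b =2 dstar (~: A) b a.
Proof.
move=> i j; rewrite /dstar /parent_rel /dstar_par !inE.
have [->|ia] := eqVneq i a; have [->|ja] := eqVneq j a;
  rewrite ?aA ?eqxx ?ab ?(negPf ab) ?orbT ?orbF ?andbT ?andbF //=.
- have [->|jb] := eqVneq j b; rewrite ?aA ?(negPf bA) ?eqxx ?orbT ?orbF ?ab //=.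
  by case: (j \in A); rewrite ?eqxx ?(negPf ab) ?andbF.
- have [->|ib] := eqVneq i b; rewrite ?aA ?(negPf bA) ?eqxx ?orbT ?orbF ?ab //=.
  by case: (i \in A); rewrite ?eqxx ?(negPf ab) ?andbF.
have [->|ib] := eqVneq i b; have [->|jb] := eqVneq j b;
  rewrite ?(negPf bA) ?(negPf ja) ?(negPf ia) ?eqxx ?orbT ?orbF ?andbF ?ab //=.
all: by case: (i \in A); case: (j \in A);
  rewrite ?eqxx ?(negPf ja) ?(negPf ia) ?(negPf jb) ?(negPf ib)
  ?orbF ?andbF ?orbT ?andbT ?[b == a]eq_sym ?(negPf ab) /=.
Qed.

Lemma dstar_a j : dstar A a b a j = (j != a) && ((j \in A) || (j == b)).
Proof.
rewrite /dstar /parent_rel eqxx /= /dstar_par; congr andb.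
by case: ifP; rewrite ?eqxx ?(negPf ab).
Qed.

Lemma dstar_leaf i j : i \in A -> i != a -> dstar A a b i j = (j == a).
Proof.
move=> iA ia; rewrite /dstar /parent_rel ia /= /dstar_par iA /=.
case: (boolP (j == a)) => //= ja; case: ifP => _; first by rewrite (negPf ia).
by apply: contraTF iA => /eqP ->.
Qed.

(** The neighbours of [a] are [A] with [a] replaced by [b], so the degree is exactly [#|A|]. *)
Lemma deg_dstar_a : deg (dstar A a b) a = #|A|.
Proof.
rewrite degE (eq_card (B := mem (b |: A :\ a)%SET)).
  rewrite cardsU1 !inE (negPf bA) andbF /= [in RHS](cardsD1 a) aA.
  by rewrite add1n.
move=> j; rewrite -topredE /= dstar_a !inE; have [->|jb] := eqVneq j b.
  by rewrite eq_sym ab orbT.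
by rewrite orbF.
Qed.

Lemma deg_dstar_leaf i : i \in A -> i != a -> deg (dstar A a b) i = 1%N.
Proof.
by move=> iA ia; rewrite degE -(card1 a); apply: eq_card => j; rewrite -topredE /= dstar_leaf.
Qed.

End Dstar.

Lemma deg_eq {n : nat} (e1 e2 : rel 'I_n) : e1 =2 e2 -> forall i, deg e1 i = deg e2 i.
Proof. by move=> e12 i; rewrite !degE; apply: eq_card => j; rewrite !inE e12. Qed.

Section DstarC.
Context {n : nat} (A : {set 'I_n}) (a b : 'I_n).
Context (aA : a \in A) (bA : b \notin A).

Let aC : a \notin ~: A. Proof. by rewrite inE negbK. Qed.
Let bC : b \in ~: A. Proof. by rewrite inE. Qed.

Lemma dstar_b j : dstar A a b b j = (j != b) && ((j \notin A) || (j == a)).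
Proof. by rewrite dstarC // dstar_a // inE. Qed.

Lemma deg_dstar_b : deg (dstar A a b) b = #|~: A|.
Proof. by rewrite (deg_eq _ _ (dstarC _ _ _ aA bA)) deg_dstar_a. Qed.

Lemma deg_dstar_leafC i : i \notin A -> i != b -> deg (dstar A a b) i = 1%N.
Proof.
by move=> iA ib; rewrite (deg_eq _ _ (dstarC _ _ _ aA bA)) deg_dstar_leaf // inE.
Qed.

Lemma dstar_leafC i j : i \notin A -> i != b -> dstar A a b i j = (j == b).
Proof. by move=> iA ib; rewrite dstarC // dstar_leaf // inE. Qed.

(** The isomorphism is the position in the list [L]: [a], [b], the rest of [A], the rest of [~: A].
    This is the numbering of [double_star], whose labels from [2] to [#|A|] hang at [0] and whose
    larger labels hang at [1]. *)
Lemma dstar_iso : graph_iso (dstar A a b) (double_star n #|A|).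
Proof.
have ab : a != b by apply: contraTneq aA => ->.
pose L := [:: a, b & enum (A :\ a)%SET ++ enum (~: A :\ b)%SET].
have memL (i : 'I_n) : i \in L.
  rewrite !inE mem_cat !mem_enum !inE.
  by case: (i == a); case: (i == b); case: (i \in A).
have uL : uniq L.
  rewrite /= !inE !mem_cat !mem_enum !inE aA (negPf bA) !eqxx (negPf ab) /= ?andbF /=.
  rewrite cat_uniq !enum_uniq /= andbT; apply/hasPn => i.
  by rewrite !mem_enum !inE => /andP[_ /negPf ->]; rewrite andbF.
have sL : size L = n.
  rewrite -[RHS]card_ord -(card_uniqP uL); apply: eq_card => i; exact: memL.
have hs (i : 'I_n) : (index i L < n)%N by rewrite -{2}sL index_mem.
pose s i := Ordinal (hs i).
have sinj : injective s.
  move=> i j /(congr1 val) ij; have {}ij : index i L = index j L by [].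
  by rewrite -(nth_index a (memL i)) -(nth_index a (memL j)) ij.
have p_gt0 : (0 < #|A|)%N by apply/card_gt0P; exists a.
have sA : size (enum (A :\ a)%SET) = #|A|.-1.
  by rewrite -cardE [in RHS](cardsD1 a) aA.
have idx (i : 'I_n) : index i L = if i == a then 0%N else if i == b then 1%N
    else (index i (enum (A :\ a)%SET ++ enum (~: A :\ b)%SET)).+2.
  by rewrite /= [a == i]eq_sym [b == i]eq_sym; case: ifP => // _; case: ifP.
have s0 (i : 'I_n) : (index i L == 0)%N = (i == a).
  by rewrite idx; case: (i == a) => //; case: (i == b).
have s1 (i : 'I_n) : (index i L == 1)%N = (i == b).
  rewrite idx; have [->|_] := eqVneq i a; first by rewrite (negPf ab).
  by case: (i == b).
have tailA (i : 'I_n) : i != a -> i \in A ->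
    (index i (enum (A :\ a)%SET ++ enum (~: A :\ b)%SET) < #|A|.-1)%N.
  move=> ia iA; have iA' : i \in enum (A :\ a)%SET by rewrite mem_enum !inE ia.
  by rewrite index_cat iA' -sA index_mem.
have tailC (i : 'I_n) : i \notin A ->
    (#|A|.-1 <= index i (enum (A :\ a)%SET ++ enum (~: A :\ b)%SET))%N.
  by move=> iA; rewrite index_cat mem_enum !inE (negPf iA) andbF sA leq_addr.
have sle (i : 'I_n) : (2 <= index i L <= #|A|)%N = (i \in A) && (i != a).
  rewrite idx; have [->|ia] := eqVneq i a; first by rewrite andbF.
  have [->|ib] := eqVneq i b; first by rewrite (negPf bA).
  rewrite andbT; case: (boolP (i \in A)) => iA.
    by have := tailA i ia iA; move=> h; apply/idP; lia.
  by have := tailC i iA; move=> h; apply/negbTE; lia.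
have slt (i : 'I_n) : (#|A| < index i L)%N = (i \notin A) && (i != b).
  rewrite idx; have [->|ia] := eqVneq i a; first by rewrite aA.
  have [->|ib] := eqVneq i b; first by rewrite andbF; apply/negbTE; lia.
  rewrite andbT; case: (boolP (i \in A)) => iA.
    by have := tailA i ia iA; move=> h; apply/negbTE; lia.
  by rewrite ltnS -(prednK p_gt0) ltnS tailC.
exists s; split; first exact: injF_bij.
move=> i j; rewrite /double_star /dstar_adj [val (s i)]/(index i L : nat).
rewrite [val (s j)]/(index j L : nat).
rewrite !s0 !s1 !sle !slt.
have ba : b != a by rewrite eq_sym.
have [->|ia] := eqVneq i a.
  rewrite dstar_a // aA (negPf ab) /= !andbF !orbF andbC.
  by have [->|jb] := eqVneq j b; rewrite ?(negPf bA) ?ba ?andbT ?orbF //= orbF.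
have [->|ib] := eqVneq i b.
  rewrite dstar_b // (negPf bA) /= ?andbF ?orbF ?andbT /=.
  by have [->|ja] := eqVneq j a; rewrite ?aA ?ab ?orbT ?orbF //= andbC.
rewrite /= !andbF !andbT; case: (boolP (i \in A)) => iA.
  by rewrite dstar_leaf //= ?andbT ?andbF ?orbF.
by rewrite dstar_leafC //= ?andbT ?andbF ?orbF.
Qed.

End DstarC.

Lemma star_iso {m : nat} (c : 'I_m.+1) :
  graph_iso (parent_rel c (fun=> c)) (star_graph m.+1).
Proof.
exists (tperm c ord0); split; first by exists (tperm c ord0); exact: tpermK.
have t0 i : (val (tperm c ord0 i) == 0)%N = (i == c).
  rewrite -(inj_eq (@perm_inj _ (tperm c ord0))) tpermL.
  by rewrite -(inj_eq val_inj).
by move=> i j; rewrite /star_graph !t0 /parent_rel orbC andbC; congr orb; rewrite andbC.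
Qed.

(** When [A] is just [a], that vertex is one more pendant of [b], so the star is the double star
    with [d = 1]. *)
Lemma dstar1_iso {m : nat} (a b : 'I_m.+1) : a != b ->
  graph_iso (dstar [set a]%SET a b) (star_graph m.+1).
Proof.
move=> ab; have [s [bs sE]] := star_iso b; exists s; split=> // i j; rewrite -sE.
rewrite dstarC ?inE // 1?eq_sym // /dstar /parent_rel /dstar_par !inE.
by have [->|] := eqVneq i a; have [->|] := eqVneq j a;
  rewrite ?eqxx ?orbT ?orbF ?andbF //=.
Qed.

(** * Trees with a balanced cut *)

Lemma ler_sum_sub {R : realType} {I : finType} (P Q : pred I) (F G : I -> R) :
  (forall i, P i -> Q i /\ F i <= G i) -> (forall i, Q i -> 0 <= G i) ->
  \sum_(i | P i) F i <= \sum_(i | Q i) G i.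
Proof.
move=> PQ Q0; rewrite big_mkcond [leRHS]big_mkcond; apply: ler_sum => i _.
case: (boolP (P i)) => [/PQ[-> //]|_].
by case: ifP => // /Q0.
Qed.

Lemma exists_argmax {R : realType} {I : finType} (A : {set I}) (x : I -> R) u :
  u \in A -> exists2 a, a \in A & forall w, w \in A -> x w <= x a.
Proof.
move=> uA; have [a aA am] := arg_maxP x uA.
by exists a => // w /am.
Qed.

(** Recognizes the equality case of the comparison. Rooted at [u], the adjacencies force the parent
    map of the tree to be [dstar_par A u v]. *)
Lemma dstar_of_adj {n : nat} (e : rel 'I_n) (A : {set 'I_n}) u v :
  is_tree e -> edge_cut e A u v -> (forall w, w \in A -> w != u -> e u w) ->
  (forall w, w \notin A -> w != v -> e v w) -> e =2 dstar A u v.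
Proof.
move=> te [uA vA euv _] Au Av; have [par re] := tree_rooted e u te.
have uv : u != v by apply: contraTneq uA => ->.
have parE w : w != u -> e u w -> par w = u.
  by move=> wu; rewrite (rootedE re) eqxx /= wu => /eqP.
have pv : par v = u by apply: parE => //; rewrite eq_sym.
have pE w : w != u -> par w = dstar_par A u v w.
  move=> wu; rewrite /dstar_par; case: ifP => [/orP[wA|/eqP ->//]|].
    by apply: parE => //; exact: Au.
  move=> /norP[wA wv]; have := Av w wA wv.
  by rewrite (rootedE re) pv (negPf wu) andbF /= => /eqP.
move=> i j; rewrite (rootedE re) /dstar /parent_rel.
have [->|iu] := eqVneq i u; have [->|ju] := eqVneq j u; rewrite //= ?pE //.
Qed.

Section Compare.
Context {R : realType} {f : R -> R -> R} (hf : property_Pstar f).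

Lemma Pstar_nat_mono (s t m : nat) : (0 < s)%N -> (s <= t)%N -> (0 < m)%N ->
  f s%:R m%:R <= f t%:R m%:R.
Proof. by move=> s0 st m0; apply: (Pstar_mono hf); rewrite ?ltr0n ?ler_nat. Qed.

Lemma Pstar_nat_sym (s t : nat) : (0 < s)%N -> (0 < t)%N -> f s%:R t%:R = f t%:R s%:R.
Proof. by move=> s0 t0; apply: (Pstar_sym hf); rewrite ltr0n. Qed.

Lemma Pstar_nat_gt0 (s t : nat) : (0 < s)%N -> (0 < t)%N -> 0 < f s%:R t%:R.
Proof. by move=> s0 t0; apply: (Pstar_gt0 hf); rewrite ltr0n. Qed.

Lemma Pstar_nat_mono2 (s t s' t' : nat) : (0 < s)%N -> (s <= s')%N ->
  (0 < t)%N -> (t <= t')%N -> f s%:R t%:R <= f s'%:R t'%:R.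
Proof.
move=> s0 ss t0 tt; apply: (le_trans (Pstar_nat_mono s s' t s0 ss t0)).
have s0' := leq_trans s0 ss; have t0' := leq_trans t0 tt.
by rewrite (Pstar_nat_sym s' t) // (Pstar_nat_sym s' t') //; apply: Pstar_nat_mono.
Qed.

(* The extremal way to distribute a degree sum over an edge is [1 + s]. *)
Lemma Pstar_le1 (s d1 d2 : nat) : (0 < d1)%N -> (0 < d2)%N -> (d1 + d2 <= s.+1)%N ->
  f d1%:R d2%:R <= f 1%:R s%:R.
Proof.
move=> d10 d20 ds; have [d11|d12] := leqP d1 1.
  by apply: Pstar_nat_mono2; lia.
have [d21|d22] := leqP d2 1.
  by rewrite Pstar_nat_sym //; apply: Pstar_nat_mono2; lia.
(* Both degrees are at least 2 here. The pair [1], [d1 + d2 - 1] has the same sum and a larger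
   difference, and monotonicity then raises the second entry to [s]. *)
apply: (@le_trans _ _ (f 1%:R (d1 + d2).-1%:R)).
  have [_ _ _ _ h] := hf; apply: h; rewrite ?ltr0n //; try lia.
    by rewrite -!natrD; congr (_%:R); lia.
  rewrite [ltRHS]distrC -(@natrB _ _ 1%N); last by lia.
  rewrite [ltRHS]ger0_norm ?ler0n //.
  have [d12'|d21'] := leqP d1 d2.
    by rewrite distrC -natrB // ger0_norm ?ler0n // ltr_nat; lia.
  by rewrite -natrB 1?ltnW // ger0_norm ?ler0n // ltr_nat; lia.
by apply: Pstar_nat_mono2; lia.
Qed.

Lemma weight_sym {n : nat} (e : rel 'I_n) i j : (forall i j, e i j = e j i) -> e i j ->
  weight f e i j = weight f e j i.
Proof.
move=> es eij; apply: Pstar_nat_sym; first exact: deg_gt0 eij.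
by apply: (@deg_gt0 _ _ _ i); rewrite es.
Qed.

Lemma weight_le1 {n : nat} (e : rel 'I_n) (B : {set 'I_n}) (s : nat) i j : is_tree e ->
  e i j -> (forall k, e i k -> k \in B) -> (forall k, e j k -> k \in B) ->
  (#|B| <= s.+1)%N -> weight f e i j <= f 1%:R s%:R.
Proof.
move=> te eij iB jB Bs; have [[_ es] _] := te.
apply: Pstar_le1; [exact: deg_gt0 eij|by apply: (@deg_gt0 _ _ _ i); rewrite es|].
exact: leq_trans (deg_add_le e B i j te eij iB jB) Bs.
Qed.

(** Rooted at [a], each edge inside [A] is charged to its lower end [w]: its weight is at most [C]
    and the entry at the parent is at most [x a]. *)
Lemma inner_sum_le {n : nat} (e : rel 'I_n) (A : {set 'I_n}) a C (x : 'I_n -> R) :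
  is_tree e -> (forall i, 0 < x i) -> a \in A -> (forall w, w \in A -> x w <= x a) ->
  0 <= C -> (forall i j, i \in A -> j \in A -> e i j -> weight f e i j <= C) ->
  \sum_i \sum_(j | e i j)
      (if (i \in A) && (j \in A) then weight f e i j * (x i * x j) else 0)
    <= 2 * \sum_(w in A | w != a) C * (x w * x a).
Proof.
move=> te x0 aA am C0 hC; have [par re] := tree_rooted e a te.
have [[_ es] _] := te.
rewrite (rooted_sum re) mulr_sumr (bigID (mem A)) /=.
rewrite [X in _ + X]big1 ?addr0; last first.
  by move=> i /andP[_ /negPf iA]; rewrite iA !andbF addr0.
rewrite (eq_bigl (fun i => (i \in A) && (i != a))); last by move=> i; rewrite andbC.
apply: ler_sum => w /andP[wA wa]; rewrite wA andbT /=.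
have ew := edge_par re w wa.
(* A vertex of [A] whose parent lies outside [A] contributes nothing on the left and a nonnegative
   term on the right. *)
case: ifP => pA; last by rewrite addr0 !mulr_ge0 // ltW.
rewrite (weight_sym e (par w) w es) ?(es _ w) // [x (par w) * x w]mulrC -mulr2n mulr_natl.
rewrite lerMn2r /=; apply: ler_pM.
- by apply: ltW; apply: (weight_gt0 hf) ew; have [] := te.
- by rewrite mulr_ge0 // ltW.
- exact: hC.
by rewrite ler_pM2l // am.
Qed.

Lemma dstar_row {n : nat} (A : {set 'I_n}) a b (x : 'I_n -> R) :
  a \in A -> b \notin A ->
  \sum_(j | dstar A a b a j) weight f (dstar A a b) a j * x j =
  \sum_(w in A | w != a) f 1%:R #|A|%:R * x w + f #|A|%:R #|~: A|%:R * x b.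
Proof.
move=> aA bA; have ab : a != b by apply: contraTneq aA => ->.
have A0 : (0 < #|A|)%N by apply/card_gt0P; exists a.
rewrite (bigD1 b) /=; last by rewrite dstar_a // eq_sym ab eqxx orbT.
rewrite addrC /weight deg_dstar_a // deg_dstar_b //; congr (_ + _).
apply: eq_big => [w|w].
  rewrite dstar_a //; have [->|wb] := eqVneq w b; first by rewrite (negPf bA) andbF.
  by rewrite orbF andbT andbC.
rewrite dstar_a // => /andP[/andP[wa]]; case: (boolP (w == b)) => [|wb]; rewrite ?orbF // => wA _.
by rewrite deg_dstar_leaf // Pstar_nat_sym.
Qed.

Lemma dstar_rowC {n : nat} (A : {set 'I_n}) a b (x : 'I_n -> R) :
  a \in A -> b \notin A ->
  \sum_(j | dstar A a b b j) weight f (dstar A a b) b j * x j =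
  \sum_(w in ~: A | w != b) f 1%:R #|~: A|%:R * x w + f #|~: A|%:R #|A|%:R * x a.
Proof.
move=> aA bA; rewrite (eq_bigl (dstar (~: A) b a b)); last exact: dstarC.
have := dstar_row (~: A) b a x; rewrite finset.setCK !inE negbK => <- //.
by apply: eq_bigr => j _; rewrite /weight !(deg_eq _ _ (dstarC _ _ _ aA bA)).
Qed.

Lemma dstar_sum {n : nat} (A : {set 'I_n}) a b (x : 'I_n -> R) :
  a \in A -> b \notin A ->
  \sum_i \sum_(j | dstar A a b i j) weight f (dstar A a b) i j * (x i * x j) =
  2 * (\sum_(w in A | w != a) f 1%:R #|A|%:R * (x w * x a)
       + f #|A|%:R #|~: A|%:R * (x a * x b)
       + \sum_(w in ~: A | w != b) f 1%:R #|~: A|%:R * (x w * x b)).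
Proof.
move=> aA bA; have re := dstar_rooted A a b aA bA.
have ab : a != b by apply: contraTneq aA => ->.
have [_ es] := rooted_simple re.
rewrite (rooted_sum re).
rewrite (eq_bigr (fun w => 2 * (weight f (dstar A a b) w (dstar_par A a b w)
     * (x w * x (dstar_par A a b w))))); last first.
  move=> w wa; have ew := edge_par re w wa.
  rewrite [weight f _ _ w]weight_sym //; last by rewrite es.
  by ring.
rewrite -[LHS]mulr_sumr; congr (2 * _).
rewrite (bigID (mem A)) /= -addrA; congr (_ + _).
  apply: eq_big => [w|w /andP[wa wA]]; first by rewrite andbC.
  by rewrite /dstar_par wA /weight deg_dstar_leaf // deg_dstar_a.
rewrite (bigD1 b) /=; last by rewrite eq_sym ab bA.
congr (_ + _).
  rewrite /dstar_par eqxx orbT /weight deg_dstar_b // deg_dstar_a //.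
  rewrite Pstar_nat_sym ?[x b * _]mulrC //; apply/card_gt0P; first by exists b; rewrite inE.
  by exists a.
apply: eq_big => [w|w /andP[/andP[wa wA] wb]].
  rewrite inE; case: (boolP (w \in A)) => wA; rewrite ?andbF //=; rewrite andbT.
  by have [wa|] := eqVneq w a; last by []; move: wA; rewrite wa aA.
by rewrite /dstar_par (negPf wA) (negPf wb) /weight deg_dstar_leafC // deg_dstar_b.
Qed.

(** The neighbours of [u] lie in [A] with [u] replaced by [v], so [u] has degree at most [#|A|];
    symmetrically for [v]. *)
Lemma cut_weight_le {n : nat} (e : rel 'I_n) (A : {set 'I_n}) u v :
  is_tree e -> edge_cut e A u v -> weight f e u v <= f #|A|%:R #|~: A|%:R.
Proof.
move=> [[ei es] _] [uA vA euv Ac].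
apply: Pstar_nat_mono2.
- exact: deg_gt0 euv.
- apply: leq_trans (deg_le e (v |: (A :\ u))%SET u _) _.
    move=> k euk; rewrite !inE; case: (boolP (k \in A)) => kA.
      by rewrite andbT orbC (contraTneq _ euk) // => ->; exact: ei.
    by have [_ ->] := Ac u k uA kA euk; rewrite eqxx.
  rewrite cardsU1 (cardsD1 u A) uA leq_add2r; exact: leq_b1.
- by apply: (@deg_gt0 _ _ _ u); rewrite es.
- apply: leq_trans (deg_le e (u |: (~: A :\ v))%SET v _) _.
    move=> k evk; rewrite !inE; case: (boolP (k \in A)) => kA.
      by have [-> _] := Ac k v kA vA (etrans (es k v) evk); rewrite eqxx.
    by rewrite andbT orbC (contraTneq _ evk) // => ->; exact: ei.
  have vC : v \in ~: A by rewrite inE.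
  rewrite cardsU1 (cardsD1 v (~: A)) vC leq_add2r; exact: leq_b1.
Qed.

(** If [a] is not [u], it has no neighbour across the cut and the whole term in [x b] is gained.
    Otherwise some [w] in [A] is not adjacent to [a], and its positive term is gained. *)
Lemma cut_row_lt {n : nat} (e : rel 'I_n) (A : {set 'I_n}) u v a b (x : 'I_n -> R) :
  is_tree e -> edge_cut e A u v -> (forall i, 0 < x i) -> a \in A -> b \notin A ->
  x v <= x b -> (a != u) || [exists w in A, (w != a) && ~~ e a w] ->
  \sum_(j | e a j) weight f e a j * x j <
  \sum_(w in A | w != a) f 1%:R #|A|%:R * x w + f #|A|%:R #|~: A|%:R * x b.
Proof.
move=> te [uA vA euv Ac] x0 aA bA vb hs; have [[ei es] _] := te.
have A0 : (0 < #|A|)%N by apply/card_gt0P; exists a.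
have cA0 : (0 < #|~: A|)%N by apply/card_gt0P; exists b; rewrite inE.
have nbr i : i \in A -> forall k, e i k -> k \in (v |: A)%SET.
  move=> iA k eik; rewrite !inE; case: (boolP (k \in A)) => kA; rewrite ?orbT //.
  by have [_ ->] := Ac i k iA kA eik; rewrite eqxx.
have cB : (#|v |: A|%SET <= #|A|.+1)%N by rewrite cardsU1 vA.
have term j : e a j && (j \in A) -> ((j \in A) && (j != a)) /\
    weight f e a j * x j <= f 1%:R #|A|%:R * x j.
  move=> /andP[eaj jA]; rewrite jA /=; split.
    by apply: contraTneq eaj => ->; exact: ei.
  rewrite ler_pM2r //; apply: (weight_le1 e (v |: A)%SET) => //; exact: nbr.
have G0 j : 0 <= f 1%:R #|A|%:R * x j.
  by rewrite mulr_ge0 // ltW // Pstar_nat_gt0.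
rewrite (bigID (mem A)) /=.
have pq0 : 0 < f #|A|%:R #|~: A|%:R * x b by rewrite mulr_gt0 // Pstar_nat_gt0.
case/orP: hs => [au|/existsP[w /and3P[wA wa naw]]].
  apply: ler_ltD; first by apply: ler_sum_sub => // j /term.
  rewrite big_pred0 // => j; apply/negP => /andP[eaj jA].
  by have [ua] := Ac a j aA jA eaj; rewrite ua eqxx in au.
apply: ltr_leD.
  rewrite [ltRHS](bigD1 w) ?wA //= -[ltLHS]add0r; apply: ltr_leD.
    by rewrite mulr_gt0 // Pstar_nat_gt0.
  apply: ler_sum_sub => // j jj; have [-> ?] := term j jj; split=> //=.
  by move: jj => /andP[eaj _]; apply: contraNneq naw => <-.
have ub := cut_weight_le e A u v te (And4 uA vA euv Ac).
rewrite (eq_bigl (fun j => (a == u) && (j == v))).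
  case: eqP => [->|_]; rewrite /= ?big_pred1_eq ?big_pred0 //; last exact: ltW.
  by apply: ler_pM => //; apply: ltW => //; apply: (weight_gt0 hf) => //; have [] := te.
move=> j; apply/idP/idP => [/andP[eaj jA]|/andP[/eqP -> /eqP ->]]; last by rewrite euv.
by have [-> ->] := Ac a j aA jA eaj; rewrite !eqxx.
Qed.

End Compare.

Lemma sum_punctured_const {R : realType} {n : nat} (A : {set 'I_n}) a (F : 'I_n -> R) c :
  a \in A -> (forall w, w \in A -> w != a -> F w = c) ->
  \sum_(w in A | w != a) F w = #|A|.-1%:R * c.
Proof.
move=> aA Fc; rewrite (eq_bigr (fun=> c)) => [|w /andP[]]; last exact: Fc.
rewrite (eq_bigl (mem (A :\ a)%SET)) => [|w]; last by rewrite !inE andbC.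
by rewrite sumr_const mulr_natl; congr (_ *+ _); rewrite [in RHS](cardsD1 a) aA.
Qed.

Section Compare2.
Context {R : realType} {f : R -> R -> R} (hf : property_Pstar f).

(** The first alternative is the case where no row is strict: the maximizers on the two sides are
    [u] and [v], each adjacent to all of its side. *)
Lemma cut_compare {n : nat} (e : rel 'I_n) (A : {set 'I_n}) u v :
  is_tree e -> edge_cut e A u v ->
  e =2 dstar A u v \/ rho (Af f e) < rho (Af f (double_star n #|A|)).
Proof.
move=> te cA; have [uA vA euv Ac] := cA; have [se [ce _]] := te.
have [ei es] := se.
have cAC := cutC e A u v se cA.
have n0 : (0 < n)%N := leq_ltn_trans (leq0n u) (ltn_ord u).
have [x x0 xe] := Af_perron hf e n0 se ce.
have [a aA am] := exists_argmax A x u uA.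
have [|b bC bm] := exists_argmax (~: A) x v; first by rewrite inE.
have bA : b \notin A by rewrite inE in bC.
have aC : a \notin ~: A by rewrite inE negbK.
have A0 : (0 < #|A|)%N by apply/card_gt0P; exists a.
have cA0 : (0 < #|~: A|)%N by apply/card_gt0P; exists b.
have vC : v \in ~: A by rewrite inE.
have uC : u \notin ~: A by rewrite inE negbK.
have sd := rooted_simple (dstar_rooted A a b aA bA).
(* Stated for a general side [B] so that it serves both [A] and [~: A]. Neighbours of vertices of
   [B] lie in [B] plus [w'], a set of size [#|B| + 1], whence the bound [f 1 #|B|]. *)
have inner : forall (B : {set 'I_n}) c w w', edge_cut e B w w' -> c \in B ->
    (forall i, i \in B -> x i <= x c) ->
    \sum_i \sum_(j | e i j)
      (if (i \in B) && (j \in B) then weight f e i j * (x i * x j) else 0)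
    <= 2 * \sum_(w in B | w != c) f 1%:R #|B|%:R * (x w * x c).
  move=> B c w w' [_ w'B _ Bc] cB cm.
  have B0 : (0 < #|B|)%N by apply/card_gt0P; exists c.
  apply: (inner_sum_le hf) => //; first by apply/ltW/(Pstar_nat_gt0 hf).
  have nbr i : i \in B -> forall k, e i k -> k \in (w' |: B)%SET.
    move=> iB k eik; rewrite !inE; case: (boolP (k \in B)) => kB; rewrite ?orbT //.
    by have [_ ->] := Bc i k iB kB eik; rewrite eqxx.
  move=> i j iB jB eij; apply: (weight_le1 hf e (w' |: B)%SET) => //; try exact: nbr.
  by rewrite cardsU1 w'B.
have cross : weight f e u v * (x u * x v) <= f #|A|%:R #|~: A|%:R * (x a * x b).
  apply: ler_pM; try by rewrite ?mulr_ge0 // ltW // (weight_gt0 hf).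
    exact: (cut_weight_le hf e A u v).
  by apply: ler_pM; rewrite ?(ltW (x0 _)) ?am ?bm.
have qle : \sum_i \sum_(j | e i j) weight f e i j * (x i * x j) <=
    \sum_i \sum_(j | dstar A a b i j) weight f (dstar A a b) i j * (x i * x j).
  rewrite (dstar_sum hf) // !mulrDr.
  have /= iA := inner A a u v cA aA am.
  have /= iC := inner (~: A) b v u cAC bC bm.
  have single i0 j0 (F : 'I_n -> 'I_n -> R) : e i0 j0 ->
      \sum_i \sum_(j | e i j) (if (i == i0) && (j == j0) then F i j else 0) = F i0 j0.
    move=> e0; rewrite (bigD1 i0) //= (bigD1 j0) //= !eqxx /= big1 ?addr0.
      rewrite big1 ?addr0 // => i /negPf ii; rewrite big1 // => j _.
      by rewrite ii.
    by move=> j /andP[_ /negPf ->].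
  (* Edges are sorted into those inside [A], the cut edge in its two directions, and those inside
     [~: A]. *)
  have -> : \sum_i \sum_(j | e i j) weight f e i j * (x i * x j) =
    \sum_i \sum_(j | e i j)
      (if (i \in A) && (j \in A) then weight f e i j * (x i * x j) else 0)
    + 2 * (weight f e u v * (x u * x v)) +
    \sum_i \sum_(j | e i j)
      (if (i \in ~: A) && (j \in ~: A) then weight f e i j * (x i * x j) else 0).
    have evu : e v u by rewrite es.
    have -> : 2 * (weight f e u v * (x u * x v)) =
      \sum_i \sum_(j | e i j) (if (i == u) && (j == v) then weight f e i j * (x i * x j) else 0) +
      \sum_i \sum_(j | e i j) (if (i == v) && (j == u) then weight f e i j * (x i * x j) else 0).
      by rewrite !single // (weight_sym hf e v u es evu); ring.
    rewrite -!big_split /=; apply: eq_bigr => i _; rewrite -!big_split /=.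
    apply: eq_bigr => j eij; rewrite !inE.
    case: (boolP (i \in A)) => iA'; case: (boolP (j \in A)) => jA' /=.
    - rewrite [j == v](negbTE _); last by apply: contraNneq vA => <-.
      rewrite [i == v](negbTE _); last by apply: contraNneq vA => <-.
      by rewrite andbF !addr0.
    - have [-> ->] := Ac i j iA' jA' eij; rewrite !eqxx /= [u == v](negbTE _).
        by rewrite !add0r !addr0.
      by apply: contraNneq vA => <-.
    - have [-> ->] := Ac j i jA' iA' (etrans (es j i) eij).
      rewrite !eqxx /= [v == u](negbTE _) ?add0r ?addr0 //=.
      by apply: contraNneq vA => ->.
    - rewrite [i == u](negbTE _); last by apply: contraNneq iA' => ->.
      rewrite [j == u](negbTE _); last by apply: contraNneq jA' => ->.
      by rewrite andbF !add0r.
  by apply: lerD => //; apply: lerD => //; rewrite ler_pM2l.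
have iso := dstar_iso A a b aA bA.
have [ha|ha] := boolP ((a != u) || [exists w in A, (w != a) && ~~ e a w]).
  right; rewrite -(rho_iso f _ _ iso); apply: (Af_rho_lt hf e _ x a) => //.
  rewrite (dstar_row hf) //; apply: (cut_row_lt hf e A u v) => //.
  by rewrite bm.
have [hb|hb] := boolP ((b != v) || [exists w in ~: A, (w != b) && ~~ e b w]).
  right; rewrite -(rho_iso f _ _ iso); apply: (Af_rho_lt hf e _ x b) => //.
  rewrite (dstar_rowC hf) // -{4}[A]finset.setCK.
  apply: (cut_row_lt hf e (~: A) v u) => //.
  by rewrite am.
left; move: ha hb; rewrite !negb_or => /andP[/negPn/eqP au hA] /andP[/negPn/eqP bv hC].
subst a b; apply: dstar_of_adj => // w wA wu.
  apply: contraNT hA => ew; apply/existsP; exists w; by rewrite wA wu.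
apply: contraNT hC => ew; apply/existsP; exists w; by rewrite inE wA wu.
Qed.

End Compare2.

(** * Monotonicity along double stars *)

Lemma exists_set_card {n p : nat} : (p <= n)%N -> exists A : {set 'I_n}, #|A| = p.
Proof.
move=> pn; exists [set i in take p (enum 'I_n)]%SET.
rewrite cardsE (card_uniqP _) ?take_uniq ?enum_uniq //.
by rewrite size_takel // size_enum_ord.
Qed.

Section Step.
Context {R : realType} {f : R -> R -> R} (hf : property_Pstar f).

Lemma Pstar_nat_convex (s t m : nat) : (0 < s)%N -> (s < t)%N -> (0 < m)%N ->
  f s.+1%:R m%:R - f s%:R m%:R <= f t.+1%:R m%:R - f t%:R m%:R.
Proof.
move=> s0 st m0; rewrite -![_.+1%:R]natr1; apply: (Pstar_convex hf); rewrite ?ltr0n //.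
by rewrite natr1 ler_nat.
Qed.

(** The pendant [l] moves from [a] to [b], and the Perron vector of the old double star tests the
    new one. That vector is a constant [X] on the leaves at [a] and [Y] on those at [b]; the
    eigenvalue equations give [x a <= x b] and [X <= Y], so the gains at [b] outweigh the losses at
    [a]. *)
Lemma dstar_step {n : nat} (A : {set 'I_n}) a b l :
  a \in A -> b \notin A -> l \in A -> l != a -> (#|A| <= #|~: A|)%N ->
  rho (Af f (dstar A a b)) < rho (Af f (dstar (A :\ l) a b)).
Proof.
move=> aA bA lA la pq; have ab : a != b by apply: contraTneq aA => ->.
have re := dstar_rooted A a b aA bA; have n0 : (0 < n)%N := leq_ltn_trans (leq0n a) (ltn_ord a).
have aA' : a \in (A :\ l)%SET by rewrite !inE eq_sym la.
have bA' : b \notin (A :\ l)%SET by rewrite !inE (negPf bA) andbF.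
have re' := dstar_rooted _ a b aA' bA'.
have [x x0 xe] := Af_perron hf _ n0 (rooted_simple re) (rooted_connected re).
set r := rho (Af f (dstar A a b)) in xe *.
have p2 : (1 < #|A|)%N.
  by rewrite (cardsD1 l) lA ltnS; apply/card_gt0P; exists a.
have cA' : #|A :\ l|%SET = #|A|.-1 by rewrite [in RHS](cardsD1 l) lA.
have cAC' : #|~: (A :\ l)|%SET = #|~: A|.+1.
  by have := cardsC A; have := cardsC (A :\ l)%SET; rewrite cA'; lia.
have A0 : (0 < #|A|)%N by lia.
have A1 : (0 < #|A|.-1)%N by lia.
have C0 : (0 < #|~: A|)%N by lia.
have AC1 : (#|A|.-1 <= #|~: A|.-1)%N by lia.
have AC2 : (#|A|.-2 <= #|~: A|.-1)%N by lia.
have pS : #|A|.-1%:R = 1 + #|A|.-2%:R :> R.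
  by rewrite addrC natr1; congr (_%:R); lia.
have cvx : f 1%:R #|A|%:R - f 1%:R #|A|.-1%:R
    <= f 1%:R #|~: A|.+1%:R - f 1%:R #|~: A|%:R.
  have S1 t : (0 < t)%N -> f 1%:R t%:R = f t%:R 1%:R.
    by move=> t0; apply: (Pstar_nat_sym hf).
  rewrite (S1 #|A|) // (S1 #|A|.-1) // (S1 #|~: A|) // (S1 #|~: A|.+1) //.
  have := @Pstar_nat_convex #|A|.-1 #|~: A| 1; rewrite (prednK A0).
  by apply; lia.
have be_be' : f #|A|%:R #|~: A|%:R <= f #|A|.-1%:R #|~: A|.+1%:R.
  have [_ _ _ _ h] := hf; apply: h; rewrite ?ltr0n //.
    by rewrite -!natrD; congr (_%:R); lia.
  rewrite distrC -natrB // distrC -natrB; last by lia.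
  by rewrite !ger0_norm ?ler0n // ltr_nat; lia.
pose al := f 1%:R #|A|%:R; pose ga := f 1%:R #|~: A|%:R.
pose be := f #|A|%:R #|~: A|%:R; pose al' := f 1%:R #|A|.-1%:R.
pose ga' := f 1%:R #|~: A|.+1%:R; pose be' := f #|A|.-1%:R #|~: A|.+1%:R.
rewrite -/al -/al' -/ga -/ga' in cvx; rewrite -/be -/be' in be_be'.
have al0 : 0 < al by exact: (Pstar_nat_gt0 hf).
have ga0 : 0 < ga by exact: (Pstar_nat_gt0 hf).
have be0 : 0 < be by exact: (Pstar_nat_gt0 hf).
have al'0 : 0 < al' by exact: (Pstar_nat_gt0 hf).
have ga'0 : 0 < ga' by exact: (Pstar_nat_gt0 hf).
have al_ga : al <= ga by exact: (Pstar_nat_mono2 hf).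
have al'_al : al' <= al by apply: (Pstar_nat_mono2 hf) => //; exact: leq_pred.
have ga_ga' : ga <= ga' by exact: (Pstar_nat_mono2 hf).
have leafA w : w \in A -> w != a -> r * x w = al * x a.
  move=> wA wa; rewrite -xe (eq_bigl (pred1 a)) => [|j]; last by rewrite dstar_leaf.
  by rewrite big_pred1_eq /weight deg_dstar_leaf // deg_dstar_a.
have leafC w : w \notin A -> w != b -> r * x w = ga * x b.
  move=> wA wb; rewrite -xe (eq_bigl (pred1 b)) => [|j]; last by rewrite dstar_leafC.
  by rewrite big_pred1_eq /weight deg_dstar_leafC // deg_dstar_b.
have rl : r * x l = al * x a by exact: leafA.
have r0 : 0 < r by rewrite -(pmulr_lgt0 _ (x0 l)) rl mulr_gt0.
pose X := al * x a / r; pose Y := ga * x b / r.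
have XA w : w \in A -> w != a -> x w = X.
  by move=> wA wa; rewrite /X -(leafA w wA wa); field; rewrite gt_eqF.
have YC w : w \in ~: A -> w != b -> x w = Y.
  by rewrite inE => wA wb; rewrite /Y -(leafC w wA wb); field; rewrite gt_eqF.
have bC : b \in ~: A by rewrite inE.
have rowa : #|A|.-1%:R * (al * X) + be * x b = r * x a.
  rewrite -xe (dstar_row hf) // -/al -/be; congr (_ + _).
  by rewrite (sum_punctured_const _ _ _ (al * X)) // => w wA wa; rewrite XA.
have beC : f #|~: A|%:R #|A|%:R = be by exact: (Pstar_nat_sym hf).
have rowb : #|~: A|.-1%:R * (ga * Y) + be * x a = r * x b.
  rewrite -xe (dstar_rowC hf) // -/ga beC; congr (_ + _).
  by rewrite (sum_punctured_const _ _ _ (ga * Y)) // => w wA wa; rewrite YC.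
have rX : r * X = al * x a by rewrite /X; field; rewrite gt_eqF.
have rY : r * Y = ga * x b by rewrite /Y; field; rewrite gt_eqF.
have h12 : #|A|.-1%:R * al ^+ 2 <= #|~: A|.-1%:R * ga ^+ 2.
  by apply: ler_pM; rewrite ?sqr_ge0 ?ler_nat ?lerXn2r ?nnegrE ?(ltW al0) ?(ltW ga0) //.
set h1 := #|A|.-1%:R * al ^+ 2 in h12; set h2 := #|~: A|.-1%:R * ga ^+ 2 in h12.
(* Eliminating the leaf values from the rows of [a] and [b] leaves a two by two system in [x a] and
   [x b]. *)
have ea : (r ^+ 2 - h1) * x a = r * be * x b.
  have -> : (r ^+ 2 - h1) * x a = r * (r * x a) - h1 * x a by ring.
  have -> : h1 * x a = #|A|.-1%:R * al * (al * x a) by rewrite /h1; ring.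
  by rewrite -rowa -rX; ring.
have eb : (r ^+ 2 - h2) * x b = r * be * x a.
  have -> : (r ^+ 2 - h2) * x b = r * (r * x b) - h2 * x b by ring.
  have -> : h2 * x b = #|~: A|.-1%:R * ga * (ga * x b) by rewrite /h2; ring.
  by rewrite -rowb -rY; ring.
(* Multiplied by [x a] and [x b] respectively, [ea] and [eb] get the same right side. If
   [x b < x a], then [r^2 - h1 >= r^2 - h2 > 0] makes the first left side larger. *)
have xab : x a <= x b.
  rewrite leNgt; apply/negP => xba.
  have k2 : 0 < r ^+ 2 - h2.
    by rewrite -(pmulr_lgt0 _ (x0 b)) eb !mulr_gt0.
  have : (r ^+ 2 - h1) * x a * x a = (r ^+ 2 - h2) * x b * x b.
    by rewrite ea eb; ring.
  apply/eqP; rewrite gt_eqF // -!mulrA.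
  apply: (@lt_le_trans _ _ ((r ^+ 2 - h2) * (x a * x a))).
    by rewrite ltr_pM2l //; apply: ltr_pM => //; exact: ltW.
  by rewrite ler_pM2r ?mulr_gt0 // lerD2l lerN2.
have X0 : 0 < X by rewrite /X divr_gt0 ?mulr_gt0.
have Y0 : 0 < Y by rewrite /Y divr_gt0 ?mulr_gt0.
have XY : X <= Y.
  by rewrite /X /Y ler_pM2r ?invr_gt0 //; apply: ler_pM => //; exact: ltW.
have xl : x l = X by exact: XA.
have lC' : l \in ~: (A :\ l)%SET by rewrite !inE eqxx.
have lb : l != b by apply: contraTneq lA => ->.
have sumC' (F : 'I_n -> R) : \sum_(w in ~: (A :\ l)%SET | w != b) F w
    = F l + \sum_(w in ~: A | w != b) F w.
  rewrite (bigD1 l) /=; last by rewrite lC' lb.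
  congr (_ + _); apply: eq_bigl => w; rewrite !inE.
  by have [->|] := eqVneq w l; rewrite ?lA ?andbF //= andbT.
apply: (Af_rho_lt hf _ _ x b) => //; first exact: rooted_simple re'.
  rewrite !(dstar_sum hf) // sumC' cA' cAC' -/al -/be -/ga -/al' -/be' -/ga'.
  rewrite ler_pM2l //.
  rewrite (sum_punctured_const A a _ (al * (X * x a))) //; last first.
    by move=> w wA wa; rewrite XA.
  rewrite (sum_punctured_const (A :\ l)%SET a _ (al' * (X * x a))) //; last first.
    by move=> w; rewrite !inE => /andP[_ wA] wa; rewrite XA.
  rewrite (sum_punctured_const (~: A) b _ (ga' * (Y * x b))) //; last first.
    by move=> w wA wa; rewrite YC.
  rewrite (sum_punctured_const (~: A) b _ (ga * (Y * x b))) //; last first.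
    by move=> w wA wa; rewrite YC.
  rewrite cA' xl.
  rewrite pS.
  (* The [#|A| - 2] leaves remaining at [a] lose [al - al'] each, and the [#|~: A| - 1] old leaves
     at [b] gain [ga' - ga], which is no less by convexity. Next, [c2] treats the central edge and
     [c3] the moved leaf. *)
  have c1 : #|A|.-2%:R * ((al - al') * (X * x a)) <=
      #|~: A|.-1%:R * ((ga' - ga) * (Y * x b)).
    have Xa : 0 <= X * x a by rewrite mulr_ge0 // ltW.
    apply: ler_pM => //; first by rewrite mulr_ge0 // subr_ge0.
      by rewrite ler_nat.
    apply: ler_pM => //; first by rewrite subr_ge0.
    by apply: ler_pM => //; exact: ltW.
  have c2 : be * (x a * x b) <= be' * (x a * x b) by rewrite ler_pM2r ?mulr_gt0.
  have c3 : al * (X * x a) <= ga' * (X * x b).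
    apply: ler_pM; rewrite ?mulr_ge0 ?(ltW X0) ?(ltW al0) ?(ltW (x0 _)) //.
      by rewrite invr_ge0 ltW.
      exact: le_trans al_ga ga_ga'.
    by rewrite ler_pM2l.
  lra.
(* The row of [b] is strict: it acquires the positive term [ga' * x l] and none of its other terms
   decreases. *)
rewrite !(dstar_rowC hf) // sumC' cA' cAC' -/ga -/ga' beC.
rewrite (Pstar_nat_sym hf #|~: A|.+1) //.
rewrite -/be' -addrA -[ltLHS]add0r; apply: ltr_leD; first by rewrite mulr_gt0.
apply: lerD; last by rewrite ler_pM2r.
by apply: ler_sum => w _; rewrite ler_pM2r.
Qed.

(** The bound on [n] says that a set of [p + 1] vertices is no larger than its complement. The case
    [p = 1] reaches the star, so both inequalities between the named graphs come from this lemma. *)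
Lemma double_star_step (n p : nat) : (0 < p)%N -> (2 * p.+1 <= n)%N ->
  rho (Af f (double_star n p.+1)) < rho (Af f (double_star n p)).
Proof.
move=> p0 pn; have [|A cA] := @exists_set_card n p.+1; first by lia.
have cC : #|~: A| = (n - p.+1)%N by have := cardsC A; rewrite cA card_ord; lia.
have /card_gt0P[a aA] : (0 < #|A|)%N by rewrite cA.
have /card_gt0P[b] : (0 < #|~: A|)%N by rewrite cC; lia.
rewrite inE => bA.
have /card_gt0P[l] : (0 < #|A :\ a|%SET)%N by have := cardsD1 a A; rewrite cA aA; lia.
rewrite !inE => /andP[la lA].
have cA' : #|A :\ l|%SET = p by have := cardsD1 l A; rewrite cA lA; lia.
have i1 := dstar_iso A a b aA bA; rewrite cA in i1.
have i2 : graph_iso (dstar (A :\ l) a b) (double_star n p).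
  by rewrite -cA'; apply: dstar_iso; rewrite !inE ?(negPf bA) ?andbF // eq_sym la.
rewrite -(rho_iso f _ _ i1) -(rho_iso f _ _ i2); apply: dstar_step => //.
by rewrite cA cC; lia.
Qed.

Lemma double_star_le (n p : nat) : (3 <= p)%N -> (2 * p <= n)%N ->
  rho (Af f (double_star n p)) <= rho (Af f (double_star n 3)).
Proof.
elim: p => // p IH; rewrite leq_eqVlt => /predU1P[<- //|p3] pn.
apply: le_trans (IH _ _); [|lia|lia].
by apply: ltW; apply: double_star_step; lia.
Qed.

Lemma double_star_lt (n p : nat) : (3 < p)%N -> (2 * p <= n)%N ->
  rho (Af f (double_star n p)) < rho (Af f (double_star n 3)).
Proof.
case: p => // p p3 pn.
by apply: lt_le_trans (double_star_step n p _ _) (double_star_le n p _ _); lia.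
Qed.

Lemma double_star1_rho (n : nat) : (1 < n)%N ->
  rho (Af f (double_star n 1)) = rho (Af f (star_graph n)).
Proof.
case: n => [|[|m]] // _.
have ab : (ord0 : 'I_m.+2) != ord_max by [].
have i1 := dstar1_iso _ _ ab.
have := dstar_iso [set ord0]%SET (ord0 : 'I_m.+2) ord_max _ _.
rewrite !inE eqxx [_ == ord0]eq_sym ab cards1 => /(_ isT isT) i2.
by rewrite -(rho_iso f _ _ i1) (rho_iso f _ _ i2).
Qed.

End Step.

(** * Spiders *)

(** A leg of length 2 at [v]: the path [v], [u], [w] with [w] pendant and [u] of degree 2. *)
Definition leg {n : nat} (e : rel 'I_n) v u w : Prop :=
  [/\ v != w, (forall j, e u j = (j == v) || (j == w)) & (forall j, e w j = (j == u))].

Section Legs.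
Context {R : realType} {f : R -> R -> R} (hf : property_Pstar f).

Lemma leg_weight {n : nat} (e : rel 'I_n) v u w : leg e v u w ->
  weight f e u w <= f 1%:R 2%:R.
Proof.
move=> [vw eu ew].
have uw : e u w by rewrite eu eqxx orbT.
have wu : e w u by rewrite ew eqxx.
rewrite /weight (Pstar_nat_sym hf); [|exact: deg_gt0 uw|exact: deg_gt0 wu].
apply: (Pstar_nat_mono2 hf); [exact: deg_gt0 wu| |exact: deg_gt0 uw|].
  by rewrite -(cards1 u); apply: deg_le => k; rewrite ew inE.
have <- : #|[set v; w]%SET| = 2%N by rewrite cards2 vw.
by apply: deg_le => k; rewrite eu !inE.
Qed.

Lemma leg_weight_root {n : nat} (e : rel 'I_n) v u w (m : nat) :
  (forall i j, e i j = e j i) -> leg e v u w ->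
  (deg e v <= m)%N -> weight f e u v <= f 2%:R m%:R.
Proof.
move=> es [vw eu ew] dv.
have uv : e u v by rewrite eu eqxx.
apply: (Pstar_nat_mono2 hf) => //; first exact: deg_gt0 uv.
  have <- : #|[set v; w]%SET| = 2%N by rewrite cards2 vw.
  by apply: deg_le => k; rewrite eu !inE.
by apply: (@deg_gt0 _ _ _ u); rewrite es.
Qed.

(* [c1], [c2] are the ends with the larger entries of the two legs.  In the target, [c1]
   is the center of degree 3, with pendant vertices [d1] and [d2], and the other center
   maximizes [x] off the legs. *)
Lemma two_legs_lt_ordered {n : nat} (e : rel 'I_n) v u1 w1 u2 w2 c1 d1 c2 d2 (x : 'I_n -> R) :
  is_tree e -> leg e v u1 w1 -> leg e v u2 w2 -> w1 != w2 -> (forall i, 0 < x i) ->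
  (forall i, \sum_(j | e i j) weight f e i j * x j = rho (Af f e) * x i) ->
  (c1, d1) = (u1, w1) \/ (c1, d1) = (w1, u1) ->
  (c2, d2) = (u2, w2) \/ (c2, d2) = (w2, u2) ->
  x d1 <= x c1 -> x d2 <= x c2 -> x c2 <= x c1 ->
  rho (Af f e) < rho (Af f (double_star n 3)).
Proof.
move=> te l1 l2 w12 x0 xe cd1 cd2 x1 x2 x12.
have [se [ce _]] := te; have [ei es] := se.
have [vw1 eu1 ew1] := l1; have [vw2 eu2 ew2] := l2.
have eneq i j : e i j -> i != j.
  by move=> eij; apply: contraTneq eij => ->; exact: ei.
have u1v : u1 != v by apply: eneq; rewrite eu1 eqxx.
have u2v : u2 != v by apply: eneq; rewrite eu2 eqxx.
have u1w1 : u1 != w1 by apply: eneq; rewrite eu1 eqxx orbT.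
have u2w2 : u2 != w2 by apply: eneq; rewrite eu2 eqxx orbT.
have u12 : u1 != u2.
  apply/eqP => u12; have := eu1 w2.
  by rewrite u12 eu2 eqxx orbT eq_sym (negPf vw2) eq_sym (negPf w12).
have u1w2 : u1 != w2.
  apply/eqP => u1w; have := eu1 v; rewrite u1w ew2 eqxx [v == u2]eq_sym.
  by rewrite (negPf u2v).
have u2w1 : u2 != w1.
  apply/eqP => u2w; have := eu2 v; rewrite u2w ew1 eqxx [v == u1]eq_sym.
  by rewrite (negPf u1v).
pose s := [:: u1; w1; u2; w2].
have us : uniq s.
  by rewrite /s /= !inE !negb_or u1w1 u12 u1w2 w12 u2w2 [w1 == u2]eq_sym u2w1.
pose P0 : {set 'I_n} := [set i | i \notin s]%SET.
have vP : v \in P0.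
  rewrite !inE !negb_or [v == u1]eq_sym [v == u2]eq_sym u1v u2v vw1 vw2 //.
have [c0 c0P c0m] := exists_argmax P0 x v vP.
have xv : x v <= x c0 by exact: c0m.
have nP i j : i \in P0 -> e i j -> j != w1 /\ j != w2.
  move=> iP eij; split; apply/eqP => jw; move: eij; rewrite es jw ?ew1 ?ew2 => /eqP iu;
    by move: iP; rewrite iu !inE eqxx ?orbT.
have subE (p q k : nat) : (p + q = k -> q = k - p)%N by move=> <-; rewrite addKn.
have cw : (2 + #|~: [set w1; w2]%SET| = n)%N.
  by rewrite -[RHS]card_ord -(cardsC [set w1; w2]%SET) cards2 w12.
have dv : (deg e v <= n - 3)%N.
  apply: leq_trans (deg_le e (~: (v |: [set w1; w2])%SET) v _) _.
    move=> k evk; have [k1 k2] := nP v k vP evk; have := eneq v k evk.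
    by rewrite !inE !negb_or k1 k2 eq_sym => ->.
  have := cardsC (v |: [set w1; w2])%SET.
  rewrite cardsU1 cards2 w12 !inE !negb_or vw1 vw2 card_ord.
  by move=> /subE ->; exact: leqnn.
have hm : (0 < n - 3)%N.
  by apply: leq_trans dv; apply: (@deg_gt0 _ _ _ u1); rewrite es eu1 eqxx.
pose F i j := weight f e i j * (x i * x j).
have [par re] := tree_rooted e v te.
have edgeP i : i != v -> e i (par i) by exact: (edge_par re).
have parU u w : u != v -> leg e v u w -> par u = v.
  move=> uv [_ eu _]; have := eu v; rewrite eqxx /= (rootedE re) uv eqxx /= orbF.
  by move/eqP.
have pu1 : par u1 = v by exact: parU u1v l1.
have pu2 : par u2 = v by exact: parU u2v l2.
have pw1 : par w1 = u1.
  by have := edgeP w1; rewrite ew1 eq_sym => /(_ vw1)/eqP.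
have pw2 : par w2 = u2.
  by have := edgeP w2; rewrite ew2 eq_sym => /(_ vw2)/eqP.
have parP i : i \in P0 -> i != v -> par i \in P0.
  move=> iP iv; have ep := edgeP i iv; have [p1 p2] := nP i _ iP ep.
  rewrite !inE !negb_or p1 p2 /= !andbT; move: ep; rewrite es => ep.
  apply/andP; split; apply/eqP => pu; move: ep; rewrite pu ?eu1 ?eu2 (negPf iv) /= => /eqP iw;
    by move: iP; rewrite iw !inE eqxx ?orbT.
have Fsym i j : e i j -> F j i = F i j.
  by move=> eij; rewrite /F (weight_sym hf e i j es eij); ring.
(* Edges are counted by their lower ends in the rooting at [v]: those with lower end in [P0] stay
   inside [P0], and the other four are the leg edges. *)
have sumT : \sum_i \sum_(j | e i j) F i j =
    \sum_i \sum_(j | e i j) (if (i \in P0) && (j \in P0) then F i j else 0)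
    + 2 * (F u1 v + F u1 w1 + F u2 v + F u2 w2).
  rewrite !(rooted_sum re) [LHS](bigID (mem P0)) [in RHS](bigID (mem P0)) /=.
  rewrite [X in _ = _ + X + _]big1 ?addr0; last first.
    by move=> i /andP[_ /negPf iP]; rewrite iP andbF addr0.
  congr (_ + _).
    by apply: eq_bigr => i /andP[iv iP]; rewrite iP (parP i iP iv).
  rewrite (eq_bigl (mem s)) => [|i]; last first.
    rewrite inE negbK; apply/andP/idP => [[]//|is_]; split=> //.
    by apply: contraTneq is_ => ->; rewrite inE in vP.
  rewrite -big_uniq //= /s !big_cons big_nil pu1 pu2 pw1 pw2.
  rewrite (Fsym u1 v) ?eu1 ?eqxx // (Fsym u2 v) ?eu2 ?eqxx //.
  rewrite -(Fsym w1 u1) ?ew1 ?eqxx // -(Fsym w2 u2) ?ew2 ?eqxx //.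
  by ring.
have inner : \sum_i \sum_(j | e i j) (if (i \in P0) && (j \in P0) then F i j else 0)
    <= 2 * \sum_(w in P0 | w != c0) f 1%:R (n - 3)%:R * (x w * x c0).
  apply: (inner_sum_le hf) => //; first by apply/ltW/(Pstar_nat_gt0 hf).
  (* Vertices of [P0] are never adjacent to [w1] or [w2], so their neighbours lie in a set of
     [n - 2] vertices, which gives the bound [f 1 (n - 3)]. *)
  move=> i j iP jP eij; apply: (weight_le1 hf e (~: [set w1; w2])%SET) => //.
  - by move=> k eik; have [k1 k2] := nP i k iP eik; rewrite !inE negb_or k1 k2.
  - by move=> k eik; have [k1 k2] := nP j k jP eik; rewrite !inE negb_or k1 k2.
  - by rewrite (subE _ _ _ cw) subnSK // ltnW // -subn_gt0.
have cds : [/\ c1 \in s, d1 \in s, c2 \in s & d2 \in s].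
  by case: cd1 => -[-> ->]; case: cd2 => -[-> ->]; rewrite !inE !eqxx ?orbT.
have [c1s d1s c2s d2s] := cds.
have dist : [/\ c1 != d1, c1 != d2, c1 != c2, d1 != d2 & (d1 != c2) && (d2 != c2)].
  by case: cd1 => -[-> ->]; case: cd2 => -[-> ->];
    rewrite ?[w1 == u1]eq_sym ?[w1 == u2]eq_sym ?[w2 == u2]eq_sym u1w1 u12 u1w2 w12 u2w2 u2w1.
have [c1d1 c1d2 c1c2 d1d2 /andP[d1c2 d2c2]] := dist.
have sE i : (i \in s) = [|| i == c1, i == d1, i == c2 | i == d2].
  rewrite !inE; case: cd1 => -[-> ->]; case: cd2 => -[-> ->];
  by case: (i == u1); case: (i == w1); case: (i == u2); case: (i == w2).
(* The three-vertex side of the target. The remaining leg vertex [c2] becomes a pendant of [c0]. *)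
pose A : {set 'I_n} := [set c1; d1; d2]%SET.
have c1A : c1 \in A by rewrite !inE eqxx.
have c0A : c0 \notin A.
  have : c0 \notin s by rewrite inE in c0P.
  by rewrite sE !inE !negb_or => /and4P[-> -> _ ->].
have cardA : #|A| = 3%N.
  by rewrite /A finset.setUC cardsU1 cards2 c1d1 !inE negb_or
    [d2 == c1]eq_sym [d2 == d1]eq_sym c1d2 d1d2.
have cardC : #|~: A| = (n - 3)%N by have := cardsC A; rewrite cardA card_ord => /subE.
have sumA (G : 'I_n -> R) : \sum_(w in A | w != c1) G w = G d1 + G d2.
  rewrite (bigD1 d1) /=; last by rewrite !inE eqxx ![d1 == c1]eq_sym c1d1 orbT.
  rewrite (bigD1 d2) /=; last first.
    by rewrite !inE eqxx ![d2 == c1]eq_sym c1d2 [d2 == d1]eq_sym d1d2 !orbT.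
  rewrite big1 ?addr0 // => i; rewrite !inE.
  by case: (i == c1); case: (i == d1); case: (i == d2).
have sumC (G : 'I_n -> R) :
    \sum_(w in ~: A | w != c0) G w = G c2 + \sum_(w in P0 | w != c0) G w.
  have c2c0 : c2 != c0.
    by apply: contraTneq c2s => ->; rewrite inE in c0P.
  rewrite (bigD1 c2) /=; last first.
    by rewrite !inE !negb_or c2c0 ![c2 == _]eq_sym c1c2 d1c2 d2c2.
  congr (_ + _); apply: eq_bigl => i; rewrite [in RHS]inE sE !inE !negb_or.
  by case: (i == c1); case: (i == d1); case: (i == c2); case: (i == d2);
    rewrite ?andbT ?andbF.
have iso := dstar_iso A c1 c0 c1A c0A; rewrite cardA in iso.
have wt1 := leg_weight e v u1 w1 l1; have wt2 := leg_weight e v u2 w2 l2.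
have wv1 := leg_weight_root e v u1 w1 _ es l1 dv.
have wv2 := leg_weight_root e v u2 w2 _ es l2 dv.
have sym12 := weight_sym hf e u1 w1 es.
rewrite -(rho_iso f _ _ iso).
have f12 : f 1%:R 2%:R <= f 1%:R 3%:R by apply: (Pstar_nat_mono2 hf).
have f23 : f 2%:R (n - 3)%:R <= f 3%:R (n - 3)%:R by apply: (Pstar_nat_mono2 hf).
have f12m : f 1%:R (n - 3)%:R <= f 2%:R (n - 3)%:R by apply: (Pstar_nat_mono2 hf).
have cvx := @Pstar_nat_convex _ _ hf 1 2 (n - 3) isT isT hm.
have f12_0 : 0 < f 1%:R 2%:R by apply: (Pstar_nat_gt0 hf).
have f2m_0 : 0 < f 2%:R (n - 3)%:R by apply: (Pstar_nat_gt0 hf).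
have xu1 : x u1 <= x c1 by case: cd1 x1 => -[-> ->].
have xu2 : x u2 <= x c2 by case: cd2 x2 => -[-> ->].
have pr1 : x u1 * x w1 = x c1 * x d1 by case: cd1 => -[-> ->] //; ring.
have pr2 : x u2 * x w2 = x c2 * x d2 by case: cd2 => -[-> ->] //; ring.
have xx0 i j : 0 <= x i * x j by rewrite mulr_ge0 // ltW.
apply: (Af_rho_lt hf e _ x c1) => //.
- exact: rooted_simple (dstar_rooted A c1 c0 c1A c0A).
- rewrite sumT (dstar_sum hf) // sumA sumC cardA cardC.
  have t1 : F u1 w1 <= f 1%:R 3%:R * (x d1 * x c1).
    rewrite /F pr1 [x c1 * _]mulrC; apply: ler_pM => //; last exact: le_trans f12.
    by apply: ltW; apply: (weight_gt0 hf) => //; rewrite eu1 eqxx orbT.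
  have t2 : F u2 w2 <= f 1%:R 3%:R * (x d2 * x c1).
    apply: (@le_trans _ _ (f 1%:R 2%:R * (x c2 * x d2))).
      by rewrite /F pr2 ler_wpM2r.
    rewrite mulrC [leRHS]mulrC; apply: ler_pM => //; first exact: ltW.
    by rewrite mulrC ler_pM2l.
  have t3 : F u1 v <= f 2%:R (n - 3)%:R * (x c1 * x c0).
    apply: ler_pM => //; last by apply: ler_pM => //; exact: ltW.
    by apply: ltW; apply: (weight_gt0 hf) => //; rewrite eu1 eqxx.
  have t4 : F u2 v <= f 2%:R (n - 3)%:R * (x c2 * x c0).
    apply: ler_pM => //; last by apply: ler_pM => //; exact: ltW.
    by apply: ltW; apply: (weight_gt0 hf) => //; rewrite eu2 eqxx.
  (* The two edges at [v], of weight at most [f 2 m] with [m = n - 3], are traded for the central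
     edge [c1 c0] of weight [f 3 m] and the pendant edge [c2 c0] of weight [f 1 m]. Convexity and
     [x c2 <= x c1] pay for the loss on the second. *)
  have t5 : (f 2%:R (n - 3)%:R - f 1%:R (n - 3)%:R) * (x c2 * x c0) <=
      (f 3%:R (n - 3)%:R - f 2%:R (n - 3)%:R) * (x c1 * x c0).
    apply: ler_pM => //; first by rewrite subr_ge0.
    by rewrite ler_pM2r.
  apply: (le_trans (lerD inner (lexx _))).
  set I2 := \sum_(w in P0 | _) _.
  have : F u1 v + F u1 w1 + F u2 v + F u2 w2
      <= f 1%:R 3%:R * (x d1 * x c1) + f 1%:R 3%:R * (x d2 * x c1)
       + f 3%:R (n - 3)%:R * (x c1 * x c0) + f 1%:R (n - 3)%:R * (x c2 * x c0) by lra.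
  lra.
rewrite (dstar_row hf) // sumA cardA cardC.
have f13_0 : 0 < f 1%:R 3%:R by apply: lt_le_trans f12.
(* This bounds the old row whether [c1] is [u1] or the pendant [w1]; in the latter case the second
   term is pure slack. Strictness comes from the new neighbour [d2]. *)
apply: (@le_lt_trans _ _ (f 1%:R 2%:R * x d1 + f 2%:R (n - 3)%:R * x c0)).
  case: cd1 => -[-> ->].
    rewrite (bigD1 w1) ?eu1 ?eqxx ?orbT //= (bigD1 v) /=; last by rewrite eu1 eqxx vw1.
    rewrite big1 ?addr0 => [|i]; last first.
      by rewrite eu1; case: (i == v); case: (i == w1).
    apply: lerD; first by rewrite ler_pM2r.
    apply: ler_pM => //; last exact: ltW.
    by apply: ltW; apply: (weight_gt0 hf) => //; rewrite eu1 eqxx.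
  rewrite (eq_bigl (pred1 u1)) ?big_pred1_eq => [|i]; last by rewrite ew1.
  rewrite -[leLHS]addr0; apply: lerD; last by rewrite mulr_ge0 // ltW.
  by rewrite ler_pM2r // -sym12 // eu1 eqxx orbT.
apply: ltr_leD; last by rewrite ler_pM2r.
apply: (@le_lt_trans _ _ (f 1%:R 3%:R * x d1)); first by rewrite ler_pM2r.
by rewrite ltrDl mulr_gt0.
Qed.

Lemma two_legs_lt {n : nat} (e : rel 'I_n) v u1 w1 u2 w2 :
  is_tree e -> leg e v u1 w1 -> leg e v u2 w2 -> w1 != w2 ->
  rho (Af f e) < rho (Af f (double_star n 3)).
Proof.
move=> te l1 l2 w12; have [se [ce _]] := te.
have n0 : (0 < n)%N := leq_ltn_trans (leq0n v) (ltn_ord v).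
have [x x0 xe] := Af_perron hf e n0 se ce.
have order u w : exists c d, ((c, d) = (u, w) \/ (c, d) = (w, u)) /\ x d <= x c.
  have [wu|/ltW uw] := leP (x w) (x u).
    by exists u, w; split=> //; left.
  by exists w, u; split=> //; right.
have [c1 [d1 [cd1 x1]]] := order u1 w1.
have [c2 [d2 [cd2 x2]]] := order u2 w2.
have [x21|/ltW x12] := leP (x c2) (x c1).
  exact: (two_legs_lt_ordered e v u1 w1 u2 w2 c1 d1 c2 d2 x).
apply: (two_legs_lt_ordered e v u2 w2 u1 w1 c2 d2 c1 d1 x) => //.
by rewrite eq_sym.
Qed.

End Legs.

Lemma desc_child {n : nat} (e : rel 'I_n) r par v : rooted e r par ->
  forall w, w \in desc par v -> w != v ->
  exists c, [/\ c != r, par c = v & w \in desc par c].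
Proof.
move=> re; apply: (rooted_ind re) => [rv rv'|w wr IH wv wv'].
  by have := root_notin_desc re v; rewrite eq_sym rv' rv => /(_ isT).
have [pv|pv] := eqVneq (par w) v; first by exists w; split=> //; exact: desc_refl.
have [c [cr pc pwc]] := IH (desc_down _ _ wv wv') pv.
by exists c; split=> //; exact: desc_up.
Qed.

Lemma desc_child_proper {n : nat} (e : rel 'I_n) r par c : rooted e r par -> c != r ->
  desc par c \proper desc par (par c).
Proof.
move=> re cr; apply/properP; split; last first.
  by exists (par c); [exact: desc_refl|exact: (par_notin_desc re)].
apply/fintype.subsetP => w wc; apply: (desc_trans _ c) => //.
by rewrite inE fconnect1.
Qed.

(** The case remaining once [cut_compare] has dealt with every edge having at least 3 vertices on
    both sides. *)
Definition small_cuts {n : nat} (e : rel 'I_n) : Prop :=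
  forall A u v, edge_cut e A u v -> (#|A| <= 2)%N || (#|~: A| <= 2)%N.

Lemma card_bigcup_le {T I : finType} (C : {set I}) (F : I -> {set T}) :
  (#|\bigcup_(c in C) F c| <= \sum_(c in C) #|F c|)%N.
Proof.
elim/big_rec2: _ => [|c m B _ IH]; first by rewrite cards0.
by apply: leq_trans (leq_card_setU _ _) _; rewrite leq_add2l.
Qed.

(* Take [v] with at least 3 descendants, as few as possible: its children have at most
   2 descendants each, so it needs many children, or a parent and two children. *)
Lemma small_cuts_deg3 {n : nat} (e : rel 'I_n) : is_tree e -> (6 <= n)%N ->
  small_cuts e -> exists v, (3 <= deg e v)%N.
Proof.
move=> te n6 sc; have n0 : (0 < n)%N by apply: leq_trans n6.
pose r := Ordinal n0; have [par re] := tree_rooted e r te.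
have dr : #|desc par r| = n by rewrite (desc_root re) cardsT card_ord.
have Pr : (3 <= #|desc par r|)%N by rewrite dr; apply: leq_trans n6.
case: (@arg_minnP _ r (fun v => 3 <= #|desc par v|)%N (fun v => #|desc par v|) Pr) => v v3 vmin.
pose C := [set c | (c != r) && (par c == v)]%SET.
have cdesc c : c \in C -> (#|desc par c| <= 2)%N.
  rewrite inE => /andP[cr /eqP pc]; rewrite leqNgt; apply/negP => c3.
  have := vmin c c3; rewrite leqNgt -pc => /negP; apply.
  exact/proper_card/(desc_child_proper e r).
have dC : (#|desc par v| <= 1 + #|C| * 2)%N.
  apply: (@leq_trans #|v |: \bigcup_(c in C) desc par c|%SET).
    apply/subset_leq_card/fintype.subsetP => w wv; rewrite in_setU1.
    have [//|wv'] /= := eqVneq w v.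
    have [c [cr pc wc]] := desc_child e r par v re w wv wv'.
    by apply/bigcupP; exists c => //; rewrite inE cr pc eqxx.
  rewrite cardsU1; apply: leq_add; first exact: leq_b1.
  apply: leq_trans (card_bigcup_le _ _) _; rewrite -sum_nat_const.
  by apply: leq_sum => c; exact: cdesc.
exists v; rewrite degE.
have CN c : c \in C -> e v c.
  by rewrite inE => /andP[cr /eqP <-]; have [_ es] := rooted_simple re; rewrite es (edge_par re).
(* At the root, [6 <= n <= 1 + 2 #|C|] forces three children. Elsewhere the complement of the
   subtree has at most 2 vertices, so the subtree has at least 4, which gives two children besides
   the parent. *)
have [vr|vr] := eqVneq v r.
  have : (#|C| <= #|[pred j | e v j]|)%N.
    by apply/subset_leq_card/fintype.subsetP => c cC; rewrite inE CN.
  by move: dC; rewrite vr dr; lia.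
have : (#|par v |: C|%SET <= #|[pred j | e v j]|)%N.
  apply/subset_leq_card/fintype.subsetP => c; rewrite in_setU1 => /orP[/eqP->|cC].
    by rewrite inE (edge_par re).
  by rewrite inE CN.
rewrite cardsU1 (_ : par v \notin C); last first.
  by rewrite inE; apply/negP => /andP[pr /eqP /esym]; exact: (par_asym re).
have := sc _ _ _ (desc_cut re v vr); have := cardsC (desc par v); rewrite card_ord.
move: v3 dC n6; set a := #|desc par v|; set b := #|~: desc par v|.
by set c := #|C|; set d := #|_| => /=; lia.
Qed.

Section Spider.
Context {n : nat} {e : rel 'I_n} {v : 'I_n} {par : 'I_n -> 'I_n}.
Context (re : rooted e v par) (sc : small_cuts e) (dv : (3 <= deg e v)%N).

(** The complement of the subtree at [c] contains [v] and at least two other neighbours of [v], so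
    the subtree must be the small side of the cut. *)
Lemma child_desc_small c : c != v -> par c = v -> (#|desc par c| <= 2)%N.
Proof.
move=> cv pc; have [_ es] := rooted_simple re; have [ei _] := rooted_simple re.
have evc : e v c by rewrite es -pc (edge_par re).
have /orP[//|cC] := sc _ _ _ (desc_cut re c cv).
have : (#|(v |: [set k | e v k]) :\ c|%SET <= #|~: desc par c|)%N.
  apply/subset_leq_card/fintype.subsetP => k; rewrite !inE.
  case/andP=> kc /orP[/eqP ->|evk].
    by have := root_notin_desc re c cv; rewrite inE.
  have kv : k != v by apply: contraTneq evk => ->; exact: ei.
  have pk : par k = v.
    by move: evk; rewrite (rootedE re) eqxx /= kv => /eqP.
  apply/negP => kc'; have := root_notin_desc re c cv.
  by rewrite -pk desc_down ?inE.
have := cardsD1 c (v |: [set k | e v k])%SET; rewrite !inE evc orbT cardsU1 !inE.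
rewrite (negPf (ei v)) /= => h1 h2; have := leq_trans h2 cC.
have dE : deg e v = #|[set k | e v k]%SET| by rewrite degE cardsE.
by move: dv h1; rewrite dE; set x := #|_|; set y := #|_|; lia.
Qed.

(** [w] lies below a child [c] of [v] whose subtree has at most 2 vertices. That subtree is
    therefore [c] and [w], with [c] the parent of [w] and no room for further children. *)
Lemma spider_leg w : w != v -> par w != v -> leg e v (par w) w.
Proof.
move=> wv pwv; have [_ es] := rooted_simple re.
have wdv : w \in desc par v by rewrite (desc_root re) inE.
have [c [cv pc wc]] := desc_child e v par v re w wdv wv.
have c2 := child_desc_small c cv pc.
have wc' : w != c by apply: contraNneq pwv => ->; rewrite pc.
have pwc : par w \in desc par c by exact: desc_down.
have pww := par_neq re w wv.
have cc : c \in desc par c by exact: desc_refl.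
have pE : par w = c.
  apply: contraTeq c2 => pc'; rewrite -ltnNge.
  have -> : 3%N = #|[set w; par w; c]%SET|.
    by rewrite finset.setUC cardsU1 cards2 !inE negb_or ![c == _]eq_sym wc' pc' eq_sym pww.
  apply/subset_leq_card/fintype.subsetP => k; rewrite !inE.
  by move: wc pwc cc; rewrite !inE => wc pwc cc /orP[/orP[]|] /eqP ->.
have dE : desc par c = [set c; w]%SET.
  apply/esym/eqP; rewrite eqEcard cards2 eq_sym wc' c2 andbT.
  by apply/fintype.subsetP => k; rewrite !inE => /orP[] /eqP ->; move: cc wc; rewrite !inE.
have pdesc j : par j \in desc par c -> j != v -> (j == c) || (j == w).
  by move=> pj _; have := desc_up _ _ pj; rewrite dE !inE.
rewrite pE; split; first by rewrite eq_sym.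
  move=> j; rewrite (rootedE re) cv pc /=; apply: orb_id2l => jv.
  apply/idP/idP => [/andP[jv' /eqP cj]|/eqP ->]; last by rewrite wv pE eqxx.
  have := pdesc j; rewrite -cj cc => /(_ isT jv') /orP[/eqP jc|//].
  by move: (par_neq re j jv'); rewrite -cj jc eqxx.
move=> j; rewrite (rootedE re) wv pE /=; case: (boolP (j == c)) => //= jc.
apply/negP => /andP[jv /eqP wj]; have := pdesc j.
rewrite -wj wc (negPf jc) => /(_ isT jv) /= /eqP jw.
by move: (par_neq re j jv); rewrite -wj jw eqxx.
Qed.

Lemma leg_edge_cut u w : leg e v u w -> u != v -> edge_cut e [set u; w]%SET u v.
Proof.
move=> [vw eu ew] uv; split; rewrite ?inE ?eqxx ?eu ?eqxx //.
  by rewrite negb_or eq_sym uv vw.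
move=> i j; rewrite !inE => /orP[/eqP ->|/eqP ->].
  by rewrite eu negb_or => /andP[_ /negPf ->]; rewrite orbF => /eqP ->.
by rewrite ew negb_or => /andP[/negPf ->].
Qed.

End Spider.

(** * The three largest spectral radii *)

Lemma graph_iso_eq {n : nat} (e e1 e2 : rel 'I_n) :
  e =2 e1 -> graph_iso e1 e2 -> graph_iso e e2.
Proof. by move=> ee [s [bs h]]; exists s; split=> // i j; rewrite ee h. Qed.

Lemma third_largest {R : realType} (f : R -> R -> R) (n : nat)
  (hf : property_Pstar f) (hn : (6 <= n)%N) (T : rel 'I_n) :
  is_tree T -> ~ graph_iso T (star_graph n) -> ~ graph_iso T (double_star n 2) ->
  ~ graph_iso T (double_star n 3) ->
  rho (Af f T) < rho (Af f (double_star n 3)).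
Proof.
move=> te h1 h2 h3; rewrite ltNge; apply/negP => le3.
have [se _] := te; have [ei es] := se.
(* No cut has a smaller side of size at least 3: either the comparison is strict, or [T] is a double
   star, which is excluded for size 3 and has too small a radius for larger sizes. *)
have cut_small A u v : edge_cut T A u v -> (#|A| <= #|~: A|)%N -> (3 <= #|A|)%N -> False.
  move=> cA lAC A3; have [uA vA _ _] := cA.
  have A2n : (2 * #|A| <= n)%N by have := cardsC A; rewrite card_ord; lia.
  have [Te|lt] := cut_compare hf T A u v te cA; last first.
    have := lt_le_trans lt (double_star_le hf n #|A| A3 A2n).
    by rewrite ltNge le3.
  have iso := graph_iso_eq _ _ _ Te (dstar_iso A u v uA vA).
  move: A3; rewrite leq_eqVlt => /orP[/eqP A3|A4].
    by apply: h3; rewrite A3.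
  have : rho (Af f T) < rho (Af f (double_star n 3)).
    by rewrite [ltLHS](rho_iso f _ _ iso); exact: double_star_lt.
  by rewrite ltNge le3.
have sc : small_cuts T.
  move=> A u v cA; rewrite [(#|A| <= 2)%N]leqNgt [(#|~: A| <= 2)%N]leqNgt -negb_and.
  apply/negP => /andP[A3 C3].
  have [lAC|/ltnW lCA] := leqP #|A| #|~: A|; first exact: cut_small cA lAC A3.
  by apply: (cut_small _ _ _ (cutC _ _ _ _ se cA)) => //; rewrite finset.setCK.
have [v dv] := small_cuts_deg3 T te hn sc.
have [par re] := tree_rooted T v te.
have sl := spider_leg re sc dv.
case: (pickP [pred w | (w != v) && (par w != v)]) => [w1 /= /andP[wv1 pw1]|none].
  have l1 := sl w1 wv1 pw1.
  case: (pickP [pred w | [&& w != v, par w != v & w1 != w]]) => [w2 /= /and3P[wv2 pw2 w12]|none].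
    have := two_legs_lt hf T v _ w1 _ w2 te l1 (sl w2 wv2 pw2) w12.
    by rewrite ltNge le3.
  (* Exactly one long leg: cutting it off at [v] exhibits [T] as the double star with a side of size
     2. *)
  have [vw1 eu1 ew1] := l1; have cA := leg_edge_cut _ _ l1 pw1.
  have [uA vA _ _] := cA.
  apply: h2; have <- : #|[set par w1; w1]%SET| = 2%N by rewrite cards2 (par_neq re w1 wv1).
  apply: graph_iso_eq (dstar_iso _ _ _ uA vA).
  apply: dstar_of_adj => // w; rewrite !inE.
    by move=> /orP[/eqP ->|/eqP ->]; rewrite ?eqxx // eu1 eqxx orbT.
  rewrite negb_or => /andP[_ ww1] wv; have := none w; rewrite /= wv [w1 == w]eq_sym ww1 andbT /=.
  by move=> /negbFE /eqP pw; rewrite es -[v in T w v]pw (edge_par re).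
have parE w : w != v -> par w = v.
  by move=> wv; have := none w; rewrite /= wv /= => /negbFE /eqP.
(* No long leg: every vertex other than [v] has parent [v]. The order is destructed because
   [star_iso] needs a successor. *)
apply: h1; case: n hn T te {le3 cut_small} h2 h3 se ei es v dv par re sl none parE sc
  => [//|m] _ T _ _ _ _ _ _ v _ par re _ _ parE _.
apply: graph_iso_eq (star_iso v) => i j; rewrite (rootedE re) /parent_rel.
by congr (_ || _); apply: andb_id2l => h; rewrite parE.
Qed.

Theorem theorem3p1 (R : realType) (f : R -> R -> R) (n : nat)
  (hf : property_Pstar f) (hn : (6 <= n)%N) (T : rel 'I_n)
  (hT : is_tree T)
  (h1 : ~ graph_iso T (star_graph n))
  (h2 : ~ graph_iso T (double_star n 2))
  (h3 : ~ graph_iso T (double_star n 3)) :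
  rho (Af f T) < rho (Af f (double_star n 3)) /\
  rho (Af f (double_star n 3)) < rho (Af f (double_star n 2)) /\
  rho (Af f (double_star n 2)) < rho (Af f (star_graph n)).
Proof.
split; first exact: third_largest.
split; first by apply: (double_star_step hf); lia.
rewrite -double_star1_rho; last by lia.
by apply: (double_star_step hf); lia.
Qed.
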